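(* Let $k$ be a field. (a) A morphism $i\colon\mathfrak K\to\mathfrak A$ in $\mathsf{Top}^{\mathsf{sc}}_{\mathbb Z}$ is a stable kernel if and only if $i$ is an injective closed map and the quotient group $\mathfrak A/i(\mathfrak K)$ is complete in the quotient topology. (b) A morphism $i\colon\mathfrak K\to\mathfrak V$ in $\mathsf{Top}^{\mathsf{sc}}_k$ is a stable kernel if and only if $i$ is an injective closed map and the quotient space $\mathfrak V/i(\mathfrak K)$ is complete in the quotient topology.
   Context: All topological abelian groups have linear topology: open subgroups form a base of neighborhoods of zero. All topological $k$-vector spaces ($k$ a fixed field with the discrete topology) have linear topology: open vector subspaces form a base of neighborhoods of zero. The completion of $A$ is $A^{\wedge}=\varprojlim_{U\subset A}A/U$, with $U$ ranging over the open subgroups (resp. subspaces), topologized so that the kernels of the projections $A^{\wedge}\to A/U$ form a base of neighborhoods of zero. $A$ is separated (resp. complete) if the natural map $A\to A^{\wedge}$ is injective (resp. surjective). $\mathsf{Top}^{\mathsf{sc}}_{\mathbb Z}$ (resp. $\mathsf{Top}^{\mathsf{sc}}_k$) is the category of complete, separated topological abelian groups and continuous homomorphisms (resp. complete, separated topological $k$-vector spaces and continuous $k$-linear maps). These are additive categories in which all kernels and cokernels exist. An injective closed map is a continuous injective homomorphism taking closed subsets to closed subsets; equivalently, the image is a closed subgroup and the topology of the source is induced from the target. Let $\mathsf A$ be an additive category with kernels and cokernels. A morphism is called a kernel (resp. a cokernel) if it is a kernel (resp. a cokernel) of some morphism. A morphism $A'\to A$ is a semi-stable kernel if for every morphism $A'\to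 B'$ the pushout $B=B'\sqcup_{A'}A$ exists and $B'\to B$ is a kernel. A morphism $A\to A''$ is a semi-stable cokernel if for every morphism $C''\to A''$ the pullback $C=C''\sqcap_{A''}A$ exists and $C\to C''$ is a cokernel. A stable kernel is a semi-stable kernel whose cokernel is a semi-stable cokernel. *)

(* Defs.v *)
From HB Require Import structures.
From mathcomp Require Import all_boot all_order all_algebra generic_quotient.
From mathcomp Require Import boolp classical_sets functions.
From mathcomp Require Import topology normedtype.

Set Implicit Arguments.
Unset Strict Implicit.
Unset Printing Implicit Defensive.

Import GRing.Theory.
Local Open Scope classical_set_scope.
Local Open Scope ring_scope.
Local Open Scope quotient_scope.

(* Kernels, pushouts and stability only involve composition and zero morphisms, so
   they are defined in any preadditive category. *)
Record preadditive := Preadditive {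
  ob :> Type;
  mor : ob -> ob -> zmodType;
  idm : forall X, mor X X;
  cmp : forall X Y Z, mor Y Z -> mor X Y -> mor X Z;
  cmpA : forall X Y Z T (h : mor Z T) (g : mor Y Z) (f : mor X Y),
    cmp h (cmp g f) = cmp (cmp h g) f;
  cmp1m : forall X Y (f : mor X Y), cmp (idm Y) f = f;
  cmpm1 : forall X Y (f : mor X Y), cmp f (idm X) = f;
  cmpDl : forall X Y Z (g h : mor Y Z) (f : mor X Y),
    cmp (g + h) f = cmp g f + cmp h f;
  cmpDr : forall X Y Z (h : mor Y Z) (f g : mor X Y),
    cmp h (f + g) = cmp h f + cmp h g
}.

Section CategoryNotions.
Variable C : preadditive.
Local Notation "g \c f" := (@cmp C _ _ _ g f) (at level 40).

Definition is_kernel_of (K A B : C) (i : mor K A) (f : mor A B) : Prop :=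
  f \c i = 0 /\
  forall (T : C) (t : mor T A), f \c t = 0 -> exists! u : mor T K, i \c u = t.

Definition is_cokernel_of (A B Q : C) (p : mor B Q) (f : mor A B) : Prop :=
  p \c f = 0 /\
  forall (T : C) (t : mor B T), t \c f = 0 -> exists! u : mor Q T, u \c p = t.

Definition is_kernel (K A : C) (i : mor K A) : Prop :=
  exists (B : C) (f : mor A B), is_kernel_of i f.

Definition is_cokernel (B Q : C) (p : mor B Q) : Prop :=
  exists (A : C) (f : mor A B), is_cokernel_of p f.

(* The square     A' --i--> A
                  |f        |g
                  B' --j--> B    is cocartesian. *)
Definition is_pushout (A' A B' B : C)
    (i : mor A' A) (f : mor A' B') (j : mor B' B) (g : mor A B) : Prop :=
  g \c i = j \c f /\
  forall (T : C) (u : mor A T) (v : mor B' T), u \c i = v \c f ->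
    exists! w : mor B T, w \c g = u /\ w \c j = v.

(* The square     P --q--> C''
                  |g       |f
                  A --p--> A''   is cartesian. *)
Definition is_pullback (A A'' C'' P : C)
    (p : mor A A'') (f : mor C'' A'') (q : mor P C'') (g : mor P A) : Prop :=
  p \c g = f \c q /\
  forall (T : C) (u : mor T A) (v : mor T C''), p \c u = f \c v ->
    exists! w : mor T P, g \c w = u /\ q \c w = v.

Definition semi_stable_kernel (A' A : C) (i : mor A' A) : Prop :=
  forall (B' : C) (f : mor A' B'),
    exists (B : C) (j : mor B' B) (g : mor A B),
      is_pushout i f j g /\ is_kernel j.

Definition semi_stable_cokernel (A A'' : C) (p : mor A A'') : Prop :=
  forall (C'' : C) (f : mor C'' A''),
    exists (P : C) (q : mor P C'') (g : mor P A),
      is_pullback p f q g /\ is_cokernel q.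

Definition stable_kernel (K A : C) (i : mor K A) : Prop :=
  semi_stable_kernel i /\
  exists (Q : C) (p : mor A Q), is_cokernel_of p i /\ semi_stable_cokernel p.

End CategoryNotions.

Definition injective_closed_map (X Y : topologicalType) (f : X -> Y) : Prop :=
  injective f /\ forall F : set X, closed F -> closed (f @` F).

(* The projective limit of the quotients A / U, for U ranging over a family S
   of subgroups of A ordered by inclusion; the transition map A / S i -> A / S j
   is x |-> \pi (repr x). *)
Section Completion.
Variables (A : zmodType) (I : Type) (S : I -> zmodClosed A).

Record lim_quot := LimQuot {
  lim_proj : forall i, Quotient.quot (S i);
  lim_compat : forall i j, {subset S i <= S j} ->
    \pi_(Quotient.quot (S j)) (repr (lim_proj i)) = lim_proj j
}.

Lemma to_lim_compat (a : A) i j : {subset S i <= S j} ->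
  \pi_(Quotient.quot (S j)) (repr (\pi_(Quotient.quot (S i)) a))
  = \pi_(Quotient.quot (S j)) a.
Proof.
move=> ij; apply/eqP; rewrite -Quotient.idealrBE; apply: ij.
by rewrite Quotient.idealrBE reprK.
Qed.

Definition to_lim (a : A) : lim_quot := LimQuot (@to_lim_compat a).

End Completion.

Section LinearTopologyGroup.
Variable A : topologicalZmodType.

Record open_subgroup := OpenSubgroup {
  open_subgroup_val :> zmodClosed A;
  open_subgroup_open : open [set x | x \in open_subgroup_val]
}.

Definition linear_topology : Prop :=
  forall W : set A, nbhs 0 W -> exists U : open_subgroup, [set x | x \in U] `<=` W.

Definition separated : Prop := injective (to_lim open_subgroup_val).
Definition complete : Prop := forall c, exists a, to_lim open_subgroup_val a = c.

End LinearTopologyGroup.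

Section TopologicalQuotient.
Variables (A : topologicalZmodType) (N : zmodClosed A).

Definition topquot : Type := Quotient.quot N.
HB.instance Definition _ := GRing.Zmodule.copy topquot (Quotient.quot N).

Definition topquot_pi (a : A) : topquot := \pi_(Quotient.quot N) a.

Definition topquot_open (W : set topquot) : Prop := open (topquot_pi @^-1` W).

Lemma topquot_openT : topquot_open setT.
Proof. by rewrite /topquot_open preimage_setT; exact: openT. Qed.

Lemma topquot_openI : setI_closed topquot_open.
Proof. by move=> U V; rewrite /topquot_open preimage_setI; exact: openI. Qed.

Lemma topquot_open_bigU (I : Type) (f : I -> set topquot) :
  (forall i, topquot_open (f i)) -> topquot_open (\bigcup_i f i).
Proof.
move=> fo; rewrite /topquot_open preimage_bigcup; apply: bigcup_open => i _; exact: fo.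
Qed.

HB.instance Definition _ :=
  isOpenTopological.Build topquot topquot_openT topquot_openI topquot_open_bigU.

Lemma topquot_piB (a b : A) : topquot_pi (a - b) = topquot_pi a - topquot_pi b.
Proof. exact: (raddfB (\pi_(Quotient.quot N))). Qed.

Lemma topquot_piP (x : topquot) : exists a, topquot_pi a = x.
Proof. by exists (repr (x : Quotient.quot N)); exact: reprK. Qed.

Lemma topquot_pi_cts : continuous topquot_pi.
Proof. exact/continuousP. Qed.

Lemma topquot_pi_nbhs (a : A) (W : set A) :
  nbhs a W -> nbhs (topquot_pi a) (topquot_pi @` W).
Proof.
rewrite nbhsE => -[O [oO Oa] OW].
apply: (@filterS _ _ _ (topquot_pi @` O)); first exact: image_subset.
apply: open_nbhs_nbhs; split; last by exists a.
rewrite /open /= /topquot_open.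
have -> : topquot_pi @^-1` (topquot_pi @` O) =
    \bigcup_(n in [set n | n \in N]) ((fun x => x - n) @^-1` O).
  apply/seteqP; split=> x /=.
    move=> [y Oy /eqP yx]; exists (x - y) => /=; last by rewrite subKr.
    by rewrite Quotient.idealrBE eq_sym.
  move=> [n Nn Oxn]; exists (x - n) => //.
  apply/eqP; rewrite /topquot_pi -Quotient.idealrBE.
  by rewrite addrAC subrr add0r rpredN.
apply: bigcup_open => n _.
suff /continuousP : continuous (fun x : A => x - n) by apply.
move=> x; apply: (@continuous_comp _ _ _ (fun x => (x, n))
  (fun z : A * A => z.1 - z.2)); last exact: sub_continuous.
by apply: cvg_pair; [exact: cvg_id|exact: cvg_cst].
Qed.

Lemma topquot_sub_cts : continuous (fun z : topquot * topquot => z.1 - z.2).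
Proof.
move=> [x y]; have [a <-] := topquot_piP x; have [b <-] := topquot_piP y.
move=> W /=; rewrite -topquot_piB => /topquot_pi_cts.
move=> /(@sub_continuous A (a, b)) [[P Q] /= [Pa Qb] PQ].
exists (topquot_pi @` P, topquot_pi @` Q); first by split; exact: topquot_pi_nbhs.
move=> [_ _] [/= [p Pp <-] [q Qq <-]].
by have := PQ (p, q) (conj Pp Qq); rewrite /= topquot_piB.
Qed.

HB.instance Definition _ :=
  PreTopologicalNmodule_isTopologicalZmodule.Build topquot topquot_sub_cts.

End TopologicalQuotient.

Record topZsc := TopZsc {
  topZsc_car :> topologicalZmodType;
  topZsc_linear : linear_topology topZsc_car;
  topZsc_separated : separated topZsc_car;
  topZsc_complete : complete topZsc_car
}.

Section ContinuousAdditive.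
Variables A B : topologicalZmodType.

Definition cts_additive_pred : pred (A -> B) :=
  fun f => `[< zmod_morphism f /\ continuous f >].

Lemma cts_additive_closed : zmod_closed cts_additive_pred.
Proof.
split=> [|f g /asboolP[fa fc] /asboolP[ga gc]]; apply/asboolP; split.
- by move=> x y /=; rewrite subrr.
- exact: cst_continuous.
- move=> x y; rewrite !fctE fa ga !opprB -!addrA; congr (_ + _).
  by rewrite addrCA [RHS]addrCA [- f y + _]addrC.
- move=> x; apply: (@continuous_comp _ _ _ (fun x => (f x, g x))
    (fun z : B * B => z.1 - z.2)); last exact: sub_continuous.
  by apply: cvg_pair; [exact: fc|exact: gc].
Qed.

HB.instance Definition _ := GRing.isZmodClosed.Build _ cts_additive_pred
  cts_additive_closed.

Record cts_additive := CtsAdditive {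
  cts_additive_fun :> A -> B;
  cts_additiveP : cts_additive_fun \in cts_additive_pred
}.

HB.instance Definition _ := [isSub for cts_additive_fun].
HB.instance Definition _ := [Choice of cts_additive by <:].
HB.instance Definition _ := [SubChoice_isSubZmodule of cts_additive by <:].

End ContinuousAdditive.

Lemma cts_additive_ext (A B : topologicalZmodType) (f g : cts_additive A B) :
  (forall x, f x = g x) -> f = g.
Proof. by move=> fg; apply/val_inj/funext. Qed.

Lemma cts_additive_id_subproof (A : topologicalZmodType) :
  (id : A -> A) \in @cts_additive_pred A A.
Proof. by apply/asboolP; split=> // x; exact: cvg_id. Qed.

Definition cts_additive_id (A : topologicalZmodType) : cts_additive A A :=
  CtsAdditive (cts_additive_id_subproof A).

Lemma cts_additive_comp_subproof (A B D : topologicalZmodType)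
    (g : cts_additive B D) (f : cts_additive A B) :
  g \o f \in @cts_additive_pred A D.
Proof.
have /asboolP[ga gc] := cts_additiveP g; have /asboolP[fa fc] := cts_additiveP f.
apply/asboolP; split=> [x y|x]; first by rewrite /= fa ga.
by apply: continuous_comp; [exact: fc|exact: gc].
Qed.

Definition cts_additive_comp (A B D : topologicalZmodType)
    (g : cts_additive B D) (f : cts_additive A B) : cts_additive A D :=
  CtsAdditive (cts_additive_comp_subproof g f).

Lemma cts_additiveD (A B : topologicalZmodType) (f : cts_additive A B) :
  {morph f : x y / x + y}.
Proof.
have /asboolP[fa _] := cts_additiveP f.
have f0 : f 0 = 0 by rewrite -(subrr 0) fa subrr.
have fN x : f (- x) = - f x by rewrite -[- x]add0r fa f0 add0r.
by move=> x y; rewrite -[y in LHS]opprK fa fN opprK.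
Qed.

Lemma cts_additive_compA (A B D E : topologicalZmodType)
    (h : cts_additive D E) (g : cts_additive B D) (f : cts_additive A B) :
  cts_additive_comp h (cts_additive_comp g f)
  = cts_additive_comp (cts_additive_comp h g) f.
Proof. exact: cts_additive_ext. Qed.

Lemma cts_additive_comp1l (A B : topologicalZmodType) (f : cts_additive A B) :
  cts_additive_comp (cts_additive_id B) f = f.
Proof. exact: cts_additive_ext. Qed.

Lemma cts_additive_comp1r (A B : topologicalZmodType) (f : cts_additive A B) :
  cts_additive_comp f (cts_additive_id A) = f.
Proof. exact: cts_additive_ext. Qed.

Lemma cts_additive_compDl (A B D : topologicalZmodType)
    (g h : cts_additive B D) (f : cts_additive A B) :
  cts_additive_comp (g + h) f = cts_additive_comp g f + cts_additive_comp h f.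
Proof. exact: cts_additive_ext. Qed.

Lemma cts_additive_compDr (A B D : topologicalZmodType)
    (h : cts_additive B D) (f g : cts_additive A B) :
  cts_additive_comp h (f + g) = cts_additive_comp h f + cts_additive_comp h g.
Proof. by apply: cts_additive_ext => x; exact: cts_additiveD. Qed.

Definition TopScZ : preadditive :=
  @Preadditive topZsc (fun A B => cts_additive A B)
    (fun A => cts_additive_id A) (fun A B D => @cts_additive_comp A B D)
    (fun A B D E => @cts_additive_compA A B D E)
    (fun A B => @cts_additive_comp1l A B) (fun A B => @cts_additive_comp1r A B)
    (fun A B D => @cts_additive_compDl A B D)
    (fun A B D => @cts_additive_compDr A B D).

Section ImageSubgroup.
Variables (A B : topologicalZmodType) (f : cts_additive A B).

Definition image_subgroup_pred : pred B := fun y => `[< range f y >].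

Lemma image_subgroup_closed : zmod_closed image_subgroup_pred.
Proof.
have /asboolP[fa _] := cts_additiveP f.
split=> [|_ _ /asboolP[x _ <-] /asboolP[y _ <-]]; apply/asboolP.
  by exists 0 => //; rewrite -(subrr 0) fa subrr.
by exists (x - y) => //; rewrite fa.
Qed.

HB.instance Definition _ :=
  GRing.isZmodClosed.Build B image_subgroup_pred image_subgroup_closed.

Definition image_subgroup : zmodClosed B :=
  GRing.ZmodClosed.clone _ image_subgroup_pred _.

End ImageSubgroup.

(* Topological vector spaces over a field k with the discrete topology. The
   library's structures joining a topology with an lmodType only allow scalars in
   a numDomainType, so the scaling operation is a field of the structure here and
   the lmodType instance is derived from it. *)
HB.mixin Record hasDiscreteScale (k : fieldType) V & TopologicalZmodule V := {
  tscale : k -> V -> V;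
  tscaleA : forall a b v, tscale a (tscale b v) = tscale (a * b) v;
  tscale1 : left_id 1 tscale;
  tscaleDr : right_distributive tscale +%R;
  tscaleDl : forall v, {morph tscale^~ v : a b / a + b};
  tscale_continuous :
    continuous (fun z : discrete_topology k * V => tscale z.1 z.2)
}.

#[short(type="topVectType")]
HB.structure Definition TopVect (k : fieldType) :=
  {V of TopologicalZmodule V & hasDiscreteScale k V}.

HB.instance Definition _ (k : fieldType) (V : topVectType k) :=
  GRing.Zmodule_isLmodule.Build k (TopVect.sort V)
    tscaleA tscale1 tscaleDr tscaleDl.

Section SubspaceSubgroup.
Variables (k : fieldType) (V : topVectType k) (N : submodClosed V).

Definition submod_pred : pred V := [pred v | v \in N].

Lemma submod_zmod_closed : zmod_closed submod_pred.
Proof. exact/GRing.subsemimod_closedB/GRing.subsemimodClosedP. Qed.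

HB.instance Definition _ :=
  GRing.isZmodClosed.Build V submod_pred submod_zmod_closed.

Definition submod_zmod : zmodClosed V :=
  GRing.ZmodClosed.clone _ submod_pred _.

End SubspaceSubgroup.

Section LinearTopologyVect.
Variables (k : fieldType) (V : topVectType k).

Record open_subspace := OpenSubspace {
  open_subspace_val :> submodClosed V;
  open_subspace_open : open [set x | x \in open_subspace_val]
}.

Definition vlinear_topology : Prop :=
  forall W : set V, nbhs 0 W -> exists U : open_subspace, [set x | x \in U] `<=` W.

Definition to_vcompletion :
    V -> lim_quot (fun U : open_subspace => submod_zmod U) :=
  to_lim (fun U : open_subspace => submod_zmod U).

Definition vseparated : Prop := injective to_vcompletion.
Definition vcomplete : Prop := forall c, exists v, to_vcompletion v = c.

End LinearTopologyVect.

Section TopologicalVectQuotient.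
Variables (k : fieldType) (V : topVectType k) (N : submodClosed V).

Definition topvquot : Type := topquot (submod_zmod N).
HB.instance Definition _ :=
  TopologicalZmodule.copy topvquot (topquot (submod_zmod N)).

Definition topvquot_pi (v : V) : topvquot := @topquot_pi V (submod_zmod N) v.

Definition topvquot_scale (a : k) (x : topvquot) : topvquot :=
  topvquot_pi (a *: repr (x : Quotient.quot (submod_zmod N))).

Lemma topvquot_scale_pi a v :
  topvquot_scale a (topvquot_pi v) = topvquot_pi (a *: v).
Proof.
apply/eqP; rewrite /topvquot_scale /topvquot_pi /topquot_pi -Quotient.idealrBE.
rewrite -scalerBr; apply: (@GRing.rpredZ _ _ N).
have : repr (\pi_(Quotient.quot (submod_zmod N)) v) - v \in submod_zmod N.
  by rewrite Quotient.idealrBE reprK.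
by [].
Qed.

Lemma topvquot_piP (x : topvquot) : exists v, topvquot_pi v = x.
Proof. exact: topquot_piP. Qed.

Lemma topvquot_piD v w : topvquot_pi (v + w) = topvquot_pi v + topvquot_pi w.
Proof. exact: (raddfD (\pi_(Quotient.quot (submod_zmod N)))). Qed.

Lemma topvquot_scaleA a b x :
  topvquot_scale a (topvquot_scale b x) = topvquot_scale (a * b) x.
Proof.
by have [v <-] := topvquot_piP x; rewrite !topvquot_scale_pi scalerA.
Qed.

Lemma topvquot_scale1 : left_id 1 topvquot_scale.
Proof.
by move=> x; have [v <-] := topvquot_piP x; rewrite topvquot_scale_pi scale1r.
Qed.

Lemma topvquot_scaleDr : right_distributive topvquot_scale +%R.
Proof.
move=> a x y; have [v <-] := topvquot_piP x; have [w <-] := topvquot_piP y.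
by rewrite -topvquot_piD !topvquot_scale_pi scalerDr topvquot_piD.
Qed.

Lemma topvquot_scaleDl x : {morph topvquot_scale^~ x : a b / a + b}.
Proof.
move=> a b; have [v <-] := topvquot_piP x.
by rewrite !topvquot_scale_pi scalerDl topvquot_piD.
Qed.

Lemma topvquot_scale_cts :
  continuous (fun z : discrete_topology k * topvquot => topvquot_scale z.1 z.2).
Proof.
move=> [a x]; have [v <-] := topvquot_piP x => W /=.
rewrite topvquot_scale_pi => /topquot_pi_cts.
move=> /(@tscale_continuous k V (a, v)) [[P Q] /= [Pa Qv] PQ].
exists (P, topvquot_pi @` Q); first by split=> //; exact: topquot_pi_nbhs.
move=> [b _] [/= Pb [w Qw <-]].
by rewrite topvquot_scale_pi; exact: (PQ (b, w) (conj Pb Qw)).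
Qed.

HB.instance Definition _ := hasDiscreteScale.Build k topvquot
  topvquot_scaleA topvquot_scale1 topvquot_scaleDr topvquot_scaleDl
  topvquot_scale_cts.

End TopologicalVectQuotient.

Record topVsc (k : fieldType) := TopVsc {
  topVsc_car :> topVectType k;
  topVsc_linear : vlinear_topology topVsc_car;
  topVsc_separated : vseparated topVsc_car;
  topVsc_complete : vcomplete topVsc_car
}.

Section ContinuousLinear.
Variables (k : fieldType) (V W : topVectType k).

Definition cts_linear_pred : pred (V -> W) :=
  fun f => `[< linear f /\ continuous f >].

Lemma cts_linear_closed : zmod_closed cts_linear_pred.
Proof.
split=> [|f g /asboolP[fl fc] /asboolP[gl gc]]; apply/asboolP; split.
- by move=> a x y /=; rewrite scaler0 addr0.
- exact: cst_continuous.
- move=> a x y; rewrite !fctE fl gl scalerBr opprD !addrA; congr (_ - _).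
  by rewrite -!addrA; congr (_ + _); rewrite addrC.
- move=> x; apply: (@continuous_comp _ _ _ (fun x => (f x, g x))
    (fun z : W * W => z.1 - z.2)); last exact: sub_continuous.
  by apply: cvg_pair; [exact: fc|exact: gc].
Qed.

HB.instance Definition _ := GRing.isZmodClosed.Build _ cts_linear_pred
  cts_linear_closed.

Record cts_linear := CtsLinear {
  cts_linear_fun :> V -> W;
  cts_linearP : cts_linear_fun \in cts_linear_pred
}.

HB.instance Definition _ := [isSub for cts_linear_fun].
HB.instance Definition _ := [Choice of cts_linear by <:].
HB.instance Definition _ := [SubChoice_isSubZmodule of cts_linear by <:].

End ContinuousLinear.

Section ContinuousLinearCategory.
Variable k : fieldType.
Implicit Types A B D E : topVectType k.

Lemma cts_linear_ext A B (f g : cts_linear A B) : (forall x, f x = g x) -> f = g.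
Proof. by move=> fg; apply/val_inj/funext. Qed.

Lemma cts_linear_id_subproof A : (id : A -> A) \in @cts_linear_pred k A A.
Proof. by apply/asboolP; split=> // x; exact: cvg_id. Qed.

Definition cts_linear_id A : cts_linear A A :=
  CtsLinear (cts_linear_id_subproof A).

Lemma cts_linear_comp_subproof A B D (g : cts_linear B D) (f : cts_linear A B) :
  g \o f \in @cts_linear_pred k A D.
Proof.
have /asboolP[gl gc] := cts_linearP g; have /asboolP[fl fc] := cts_linearP f.
apply/asboolP; split=> [a x y|x]; first by rewrite /= fl gl.
by apply: continuous_comp; [exact: fc|exact: gc].
Qed.

Definition cts_linear_comp A B D (g : cts_linear B D) (f : cts_linear A B) :
  cts_linear A D := CtsLinear (cts_linear_comp_subproof g f).

Lemma cts_linear_compA A B D E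
    (h : cts_linear D E) (g : cts_linear B D) (f : cts_linear A B) :
  cts_linear_comp h (cts_linear_comp g f)
  = cts_linear_comp (cts_linear_comp h g) f.
Proof. exact: cts_linear_ext. Qed.

Lemma cts_linear_comp1l A B (f : cts_linear A B) :
  cts_linear_comp (cts_linear_id B) f = f.
Proof. exact: cts_linear_ext. Qed.

Lemma cts_linear_comp1r A B (f : cts_linear A B) :
  cts_linear_comp f (cts_linear_id A) = f.
Proof. exact: cts_linear_ext. Qed.

Lemma cts_linear_compDl A B D (g h : cts_linear B D) (f : cts_linear A B) :
  cts_linear_comp (g + h) f = cts_linear_comp g f + cts_linear_comp h f.
Proof. exact: cts_linear_ext. Qed.

Lemma cts_linear_compDr A B D (h : cts_linear B D) (f g : cts_linear A B) :
  cts_linear_comp h (f + g) = cts_linear_comp h f + cts_linear_comp h g.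
Proof.
have /asboolP[hl _] := cts_linearP h.
apply: cts_linear_ext => x /=.
by have := hl 1 (f x) (g x); rewrite !scale1r.
Qed.

Definition TopScVect : preadditive :=
  @Preadditive (topVsc k) (fun A B : topVsc k => cts_linear A B)
    (fun A : topVsc k => cts_linear_id A) (fun A B D : topVsc k => @cts_linear_comp A B D)
    (fun A B D E : topVsc k => @cts_linear_compA A B D E)
    (fun A B : topVsc k => @cts_linear_comp1l A B) (fun A B : topVsc k => @cts_linear_comp1r A B)
    (fun A B D : topVsc k => @cts_linear_compDl A B D)
    (fun A B D : topVsc k => @cts_linear_compDr A B D).

End ContinuousLinearCategory.

Section ImageSubspace.
Variables (k : fieldType) (V W : topVectType k) (f : cts_linear V W).

Definition image_subspace_pred : pred W := fun y => `[< range f y >].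

Lemma image_subspace_closed : GRing.subsemimod_closed image_subspace_pred.
Proof.
have /asboolP[fl _] := cts_linearP f.
have f0 : f 0 = 0 by have := fl (-1) 0 0; rewrite scaler0 addr0 scaleN1r addNr.
split=> [|a _ /asboolP[x _ <-]]; last first.
  by apply/asboolP; exists (a *: x) => //; have := fl a x 0; rewrite !addr0 f0 addr0.
split=> [|_ _ /asboolP[x _ <-] /asboolP[y _ <-]]; apply/asboolP.
  by exists 0.
by exists (x + y) => //; have := fl 1 x y; rewrite !scale1r.
Qed.

HB.instance Definition _ :=
  GRing.isSubmodClosed.Build k W image_subspace_pred image_subspace_closed.

Definition image_subspace : submodClosed W :=
  GRing.SubmodClosed.clone _ _ image_subspace_pred _.

End ImageSubspace.

(* Main.v *)
From HB Require Import structures.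
From mathcomp Require Import all_boot all_order all_algebra generic_quotient.
From mathcomp Require Import boolp classical_sets functions topology normedtype.
Require Import Defs.

Set Implicit Arguments.
Unset Strict Implicit.
Unset Printing Implicit Defensive.

Import GRing.Theory.
Local Open Scope classical_set_scope.
Local Open Scope ring_scope.
Local Open Scope quotient_scope.

(** Both categories consist of modules with a linear topology over a discrete ring [R]:
    [R] is the ring of integers for abelian groups and the field [k] for vector spaces.
    Such a topology is the same thing as its filter of open submodules, so the argument
    is made for modules with a filter of submodules, where continuity, closedness and
    completeness become first-order conditions. The criterion [stable_kernelP] holds in
    any category that is equivalent to the complete separated objects among these; the
    last part checks that the two given categories are of this kind.

    Suppose that [i : K -> A] is a closed embedding and that [A / iK] is complete. For
    [f : K -> B] the topological quotient [Q] of [A * B] by the antidiagonal copy of [K]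
    is an extension of [A / iK] by [B]. As both ends are complete, [Q] is complete
    ([graph_complete]), so it is the pushout, and [B -> Q] is the kernel of [Q -> A / iK]
    ([pushout_kernel]). Moreover [A -> A / iK] is a cokernel of [i], it is open and
    surjective, and so are its pullbacks; an open surjection is a cokernel of its kernel
    ([quotient_cokernel]).

    Conversely, let [i] be a stable kernel with cokernel [p : A -> Q]. A kernel is a closed
    embedding, since it agrees with the inclusion of a closed submodule
    ([kernel_embedding]). The map [p] is surjective: pulled back along the discretization
    of [Q], it gives a cokernel with discrete target whose image lies over [p(A)], and a
    cokernel is an epimorphism ([semi_stable_cokernel_surj]). The discrete quotients
    [A / (iK + U)] factor through [p], which makes [p] open with kernel [iK]
    ([cokernel_open_quotient]). Hence [A / iK] is isomorphic to [Q] and complete.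

    Every quotient that occurs is discrete or inherits completeness from [A / iK], so
    completions never have to be constructed. *)

(** * Families of subgroups: closure and completeness *)

Definition subgroup (A : zmodType) (U : set A) : Prop :=
  U 0 /\ forall x y, U x -> U y -> U (x - y).

Definition addset (A : zmodType) (U N : set A) : set A :=
  [set x | exists2 n, N n & U (x - n)].

Record subgroup_filter (A : zmodType) (O : set (set A)) : Prop := {
  subgroup_filterT : O setT;
  subgroup_filterI : forall U V, O U -> O V -> O (U `&` V);
  subgroup_filter_subgroup : forall U, O U -> subgroup U
}.

(** The intersection of all [U + N] is the closure of [N]. *)
Definition closed_mod (A : zmodType) (O : set (set A)) (N : set A) : Prop :=
  forall x, (forall U, O U -> addset U N x) -> N x.

(** The family [c] chooses representatives of a point of the limit of the groups
    [A / (U + N)]. The condition says that [A] maps onto that limit, which is completeness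
    of [A / N] expressed inside [A]. *)
Definition complete_mod (A : zmodType) (O : set (set A)) (N : set A) : Prop :=
  forall c : set A -> A,
    (forall U V, O U -> O V -> U `<=` V -> addset V N (c U - c V)) ->
    exists a, forall U, O U -> addset U N (a - c U).

Section Subgroups.
Variable A : zmodType.
Implicit Types (U V N : set A) (O : set (set A)).

Lemma subgroup0 U : subgroup U -> U 0. Proof. by case. Qed.

Lemma subgroupB U x y : subgroup U -> U x -> U y -> U (x - y).
Proof. by case=> _; apply. Qed.

Lemma subgroupN U x : subgroup U -> U x -> U (- x).
Proof. by move=> sU Ux; rewrite -[- x]add0r; apply: subgroupB => //; apply: subgroup0. Qed.

Lemma subgroupD U x y : subgroup U -> U x -> U y -> U (x + y).
Proof. by move=> sU Ux Uy; rewrite -[y]opprK; apply: subgroupB => //; apply: subgroupN. Qed.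

Lemma subgroup_trans U x y z : subgroup U -> U (x - y) -> U (y - z) -> U (x - z).
Proof. by move=> sU xy yz; rewrite -(subrKA y); apply: subgroupD. Qed.

Lemma subgroup_sym U x y : subgroup U -> U (x - y) -> U (y - x).
Proof. by move=> sU /(subgroupN sU); rewrite opprB. Qed.

Lemma subrACA x y z t : (x - y) - (z - t) = (x - z) - (y - t) :> A.
Proof. by rewrite !opprD addrACA. Qed.

Lemma addset_subgroup U N : subgroup U -> subgroup N -> subgroup (addset U N).
Proof.
move=> sU sN; split; first by exists 0; [exact: subgroup0|rewrite subr0; exact: subgroup0].
move=> x y [n Nn Uxn] [m Nm Uym]; exists (n - m); first exact: subgroupB.
by rewrite subrACA; exact: subgroupB.
Qed.

Lemma addsetS U V N : U `<=` V -> addset U N `<=` addset V N.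
Proof. by move=> UV x [n Nn /UV]; exists n. Qed.

Lemma addsetl U N : subgroup N -> U `<=` addset U N.
Proof. by move=> sN x Ux; exists 0; [exact: subgroup0|rewrite subr0]. Qed.

Lemma addsetr U N : subgroup U -> N `<=` addset U N.
Proof. by move=> sU x Nx; exists x => //; rewrite subrr; exact: subgroup0. Qed.

Lemma addset0 U : addset U [set 0] = U.
Proof.
apply/seteqP; split=> x; first by case=> _ ->; rewrite subr0.
by exists 0 => //; rewrite subr0.
Qed.

(** Completeness for the whole filter yields limits along any directed system [T] that
    is cofinal in it: the value at a member [V] of the filter is read off at some
    [T i] inside [V], and directedness makes the result compatible. *)
Lemma complete_along O (I : Type) (le : I -> I -> Prop) (T : I -> set A) (x : I -> A) :
  subgroup_filter O -> complete_mod O [set 0] ->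
  (forall i, O (T i)) ->
  (forall V, O V -> exists i, T i `<=` V) ->
  (forall i j, le i j -> T i `<=` T j) ->
  (forall i j, exists k, le k i /\ le k j) ->
  (forall i j, le i j -> T j (x i - x j)) ->
  exists a, forall i, T i (a - x i).
Proof.
move=> fO cO OT base mono dir coh.
have sub V : O V -> subgroup V by exact: subgroup_filter_subgroup.
have /choice[w wP] V : exists i, O V -> T i `<=` V.
  have [OV|nOV] := pselect (O V); first by have [i] := base V OV; exists i.
  by have [i _] := base setT (subgroup_filterT fO); exists i.
have near V i : O V -> T i `<=` V -> V (x (w V) - x i).
  move=> OV iV; have [k [kw ki]] := dir (w V) i.
  apply: (@subgroup_trans _ _ (x k)); first exact: sub.
    by apply: subgroup_sym; [exact: sub|apply: (wP V OV); exact: coh].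
  by apply: iV; exact: coh.
have [U V OU OV UV|a aP] := cO (x \o w).
  by rewrite addset0 /=; apply: subgroup_sym; [exact: sub|apply: near => //;
     exact: (subset_trans (wP U OU))].
exists a => i; have := aP (T i) (OT i); rewrite addset0 /= => ai.
by apply: (subgroup_trans (sub _ (OT i)) ai); exact: near.
Qed.
End Subgroups.

(** Compatible families on a quotient [Q] and compatible families modulo the kernel
    of [A -> Q] are the same thing, because the open subgroups of [Q] are the images
    of those of [A]. *)
Lemma complete_quotient (A Q : zmodType) (OA : set (set A)) (OQ : set (set Q))
    (p : {additive A -> Q}) :
  subgroup_filter OA -> subgroup_filter OQ ->
  (forall y, exists x, p x = y) ->
  (forall V, OQ V -> OA (p @^-1` V)) -> (forall U, OA U -> OQ (p @` U)) ->
  complete_mod OQ [set 0] <-> complete_mod OA [set x | p x = 0].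
Proof.
move=> fA fQ psurj ppre pim.
have addker U x : addset U [set x | p x = 0] x <-> (p @` U) (p x).
  split=> [[n /= n0 Uxn]|[u Uu pu]].
    by exists (x - n) => //; rewrite raddfB n0 subr0.
  by exists (x - u); [rewrite /= raddfB pu subrr|rewrite subKr].
have pimpre V : OQ V -> p @` (p @^-1` V) = V.
  by move=> _; apply/seteqP; split=> [_ [x Vx <-] //|y Vy]; have [x xy] := psurj y;
     exists x => //=; rewrite xy.
have sQ V : OQ V -> subgroup V by exact: subgroup_filter_subgroup.
split=> [cQ c coh|cA c coh].
- have [U V OU OV UV|y yP] := cQ (fun V => p (c (p @^-1` V))).
    rewrite addset0 -raddfB.
    have /addker := coh _ _ (ppre _ OU) (ppre _ OV) (preimage_subset UV).
    by rewrite pimpre.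
  have [a ay] := psurj y; exists a => U OU; apply/addker; rewrite raddfB ay.
  apply: (@subgroup_trans _ _ _ (p (c (p @^-1` (p @` U))))).
  + exact: sQ (pim _ OU).
  + by have := yP _ (pim _ OU); rewrite addset0.
  + apply: subgroup_sym; first exact: sQ (pim _ OU).
    have Upre : U `<=` p @^-1` (p @` U) by move=> u Uu; exists u.
    have /addker := coh _ _ OU (ppre _ (pim _ OU)) Upre.
    by rewrite raddfB pimpre //; exact: pim.
- have /choice[r rP] := psurj.
  have [U V OU OV UV|a aP] := cA (fun U => r (c (p @` U))).
    apply/addker; rewrite raddfB !rP.
    have := coh _ _ (pim _ OU) (pim _ OV) (@image_subset _ _ p _ _ UV).
    by rewrite addset0.
  exists (p a) => V OV; rewrite addset0.
  have /addker := aP _ (ppre _ OV).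
  by rewrite raddfB rP pimpre.
Qed.

(** * Linearly topologized modules *)

Definition submodule (R : nzRingType) (M : lmodType R) (U : set M) : Prop :=
  U 0 /\ forall a x y, U x -> U y -> U (a *: x + y).

Lemma submodule_subgroup (R : nzRingType) (M : lmodType R) (U : set M) :
  submodule U -> subgroup U.
Proof.
by case=> U0 UD; split=> // x y Ux Uy; rewrite addrC -scaleN1r; exact: UD.
Qed.

(** The open submodules determine a linear topology. All of them are recorded, rather
    than a base, so that continuity is stability under preimages. *)
Record ltmod (R : nzRingType) := LtMod {
  ltmod_car :> lmodType R;
  lopen : set (set ltmod_car);
  lopen_submodule : forall U, lopen U -> submodule U;
  lopenT : lopen setT;
  lopenI : forall U V, lopen U -> lopen V -> lopen (U `&` V);
  lopenS : forall U V, lopen U -> submodule V -> U `<=` V -> lopen V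
}.
Arguments lopen {R} _ _.

Definition linear_map (R : nzRingType) (M N : lmodType R) (f : M -> N) : Prop :=
  forall a x y, f (a *: x + y) = a *: f x + f y.

Definition ltmod_hom (R : nzRingType) (M N : ltmod R) (f : M -> N) : Prop :=
  linear_map f /\ forall V, lopen N V -> lopen M (f @^-1` V).

Definition lclosed (R : nzRingType) (M : ltmod R) := @closed_mod M (lopen M).
Definition lcomplete_mod (R : nzRingType) (M : ltmod R) := @complete_mod M (lopen M).

Definition complete_separated (R : nzRingType) (M : ltmod R) : Prop :=
  lclosed [set 0 : M] /\ lcomplete_mod [set 0 : M].

Section Submodules.
Variable R : nzRingType.

Lemma submoduleI (M : lmodType R) (U V : set M) :
  submodule U -> submodule V -> submodule (U `&` V).
Proof.
by move=> [U0 UD] [V0 VD]; split=> // a x y [Ux Vx] [Uy Vy]; split; [exact: UD|exact: VD].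
Qed.

Lemma submoduleT (M : lmodType R) : submodule [set: M]. Proof. by []. Qed.

Lemma submodule_zero (M : lmodType R) : submodule [set 0 : M].
Proof. by split=> // a x y -> ->; rewrite /= scaler0 addr0. Qed.

Lemma submoduleD (M : lmodType R) (U : set M) x y :
  submodule U -> U x -> U y -> U (x + y).
Proof. by move=> [_ UD] Ux Uy; rewrite -[x]scale1r; exact: UD. Qed.

Lemma submoduleZ (M : lmodType R) (U : set M) a x : submodule U -> U x -> U (a *: x).
Proof. by move=> [U0 UD] Ux; rewrite -[_ *: _]addr0; exact: UD. Qed.

Lemma submodule_addset (M : lmodType R) (U V : set M) :
  submodule U -> submodule V -> submodule (addset U V).
Proof.
move=> sU sV; split.
  exact: (addset_subgroup (submodule_subgroup sU) (submodule_subgroup sV)).1.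
move=> a x y [n Vn Ux] [m Vm Uy]; exists (a *: n + m); first exact: (proj2 sV).
by rewrite opprD addrACA -scalerBr; exact: (proj2 sU).
Qed.

Variables (M N : lmodType R) (f : M -> N).
Hypothesis lf : linear_map f.

Lemma linear_map0 : f 0 = 0.
Proof. by have := lf (-1) 0 0; rewrite scaler0 addr0 scaleN1r addNr. Qed.

Lemma linear_mapD x y : f (x + y) = f x + f y.
Proof. by have := lf 1 x y; rewrite !scale1r. Qed.

Lemma linear_mapB x y : f (x - y) = f x - f y.
Proof. by rewrite addrC -scaleN1r lf scaleN1r addrC. Qed.

Lemma linear_mapN x : f (- x) = - f x.
Proof. by rewrite -[- x]add0r linear_mapB linear_map0 add0r. Qed.

Lemma submodule_preimage V : submodule V -> submodule (f @^-1` V).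
Proof.
move=> [V0 VD]; split; first by rewrite /= linear_map0.
by move=> a x y /= Vx Vy; rewrite lf; exact: VD.
Qed.

Lemma submodule_image U : submodule U -> submodule (f @` U).
Proof.
move=> [U0 UD]; split; first by exists 0 => //; exact: linear_map0.
by move=> a _ _ [x Ux <-] [y Uy <-]; exists (a *: x + y); [exact: UD|rewrite lf].
Qed.

Lemma linear_map_inj : (forall x, f x = 0 -> x = 0) -> injective f.
Proof.
by move=> f0 x y xy; apply/eqP; rewrite -subr_eq0; apply/eqP/f0; rewrite linear_mapB xy subrr.
Qed.
End Submodules.

Section LtModTheory.
Variable R : nzRingType.
Implicit Types M N P : ltmod R.

Lemma lopen_subgroup M U : lopen M U -> subgroup U.
Proof. by move=> /lopen_submodule/submodule_subgroup. Qed.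

Lemma lopen_filter M : subgroup_filter (lopen M).
Proof. by split; [exact: lopenT|exact: lopenI|exact: lopen_subgroup]. Qed.

Lemma ltmod_hom_comp M N P (g : N -> P) (f : M -> N) :
  ltmod_hom g -> ltmod_hom f -> ltmod_hom (g \o f).
Proof.
move=> [gl gc] [fl fc]; split=> [a x y|V oV]; first by rewrite /= fl gl.
by apply: (fc (g @^-1` V)); exact: gc.
Qed.

Lemma ltmod_hom_zero M N : ltmod_hom (fun _ : M => 0 : N).
Proof.
split=> [a x y|V oV]; first by rewrite scaler0 addr0.
by apply: (lopenS (lopenT M)) => // [|x _]; [|exact: (lopen_submodule oV).1];
   split=> [|a x y _ _]; exact: (lopen_submodule oV).1.
Qed.

Lemma ltmod_homB M N (f g : M -> N) : ltmod_hom f -> ltmod_hom g -> ltmod_hom (fun x => f x - g x).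
Proof.
move=> [fl fc] [gl gc].
have l : linear_map (fun x => f x - g x).
  by move=> a x y; rewrite fl gl scalerBr opprD addrACA.
split=> // V oV; apply: (lopenS (lopenI (fc _ oV) (gc _ oV))) => [|x [fx gx]].
  by apply: submodule_preimage => //; exact: lopen_submodule oV.
by apply: subgroupB => //; exact: lopen_subgroup oV.
Qed.

Lemma ltmod_homD M N (f g : M -> N) : ltmod_hom f -> ltmod_hom g -> ltmod_hom (fun x => f x + g x).
Proof.
move=> hf hg; have := ltmod_homB hf (ltmod_homB (ltmod_hom_zero M N) hg).
by congr ltmod_hom; apply/funext => x; rewrite sub0r opprK.
Qed.

Lemma ltmod_hom_id M : ltmod_hom (@id M). Proof. by []. Qed.

Lemma lclosed_ker M N (f : M -> N) :
  lclosed [set 0 : N] -> ltmod_hom f -> lclosed [set x | f x = 0].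
Proof.
move=> sN [fl fc] x hx; apply: sN => V oV; rewrite addset0.
have [n /= fn0] := hx _ (fc _ oV).
by rewrite /= linear_mapB // fn0 subr0.
Qed.

(** For an open [N] the quotient is discrete: every family is compatible with its value
    at [N] itself, which is therefore a limit. This gives the next two lemmas. *)
Lemma lclosed_lopen M (N : set M) : lopen M N -> lclosed N.
Proof.
move=> oN x /(_ N oN) [n Nn xn]; rewrite -(subrK n x).
by apply: subgroupD => //; exact: lopen_subgroup oN.
Qed.

Lemma lcomplete_mod_lopen M (N : set M) : lopen M N -> lcomplete_mod N.
Proof.
move=> oN c coh; exists (c N) => U oU.
have oUN := lopenI oU oN.
have [sU sN] := (lopen_subgroup oU, lopen_subgroup oN).
have /coh : lopen M (U `&` N) by [].
move=> cUN; apply: (@subgroup_trans _ _ _ (c (U `&` N))); first exact: addset_subgroup.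
  apply: subgroup_sym; first exact: addset_subgroup.
  have [n Nn Nxn] := cUN N oN (@subIsetr _ _ _).
  by apply: addsetr => //; rewrite -(subrK n (_ - _)); exact: subgroupD.
exact: cUN U oU (@subIsetl _ _ _).
Qed.

(** ** Submodules with the induced topology *)
Section Sub.
Variables (M : ltmod R) (N : set M) (sN : submodule N).

(** The proof is an argument of the predicate so that the instance stating that the
    predicate is closed can be found from the predicate alone. *)
Definition sub_pred of submodule N : pred M := fun x => `[< N x >].

Lemma sub_pred_closed : GRing.subsemimod_closed (sub_pred sN).
Proof.
split; first by split; [apply/asboolP; case: sN|
  move=> x y /asboolP Nx /asboolP Ny; apply/asboolP; exact: submoduleD].
by move=> a x /asboolP Nx; apply/asboolP; exact: submoduleZ.
Qed.

HB.instance Definition _ :=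
  GRing.isSubmodClosed.Build R M (sub_pred sN) sub_pred_closed.

Record sub_car := SubCar { sub_val : M; sub_valP : sub_val \in sub_pred sN }.

HB.instance Definition _ := [isSub for sub_val].
HB.instance Definition _ := [Choice of sub_car by <:].
HB.instance Definition _ := [SubChoice_isSubLmodule of sub_car by <:].

Definition sub_open : set (set sub_car) :=
  [set W | submodule W /\ exists2 U, lopen M U & sub_val @^-1` U `<=` W].

Lemma sub_val_linear : linear_map sub_val. Proof. by []. Qed.

Definition sub_ltmod : ltmod R.
Proof.
apply: (@LtMod R sub_car sub_open).
- by move=> U [].
- by split=> //; exists setT => //; exact: lopenT.
- move=> U V [sU [U' oU UU]] [sV [V' oV VV]]; split; first exact: submoduleI.
  by exists (U' `&` V'); [exact: lopenI|move=> x [/UU Ux /VV Vx]].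
- move=> U V [sU [U' oU UU]] sV UV; split=> //.
  by exists U' => //; exact: subset_trans UV.
Defined.

Lemma sub_valK (x : sub_ltmod) : N (sub_val x).
Proof. exact/asboolP/sub_valP. Qed.

Lemma sub_val_inj : injective (sub_val : sub_ltmod -> M).
Proof. exact: val_inj. Qed.

Lemma sub_val_onto x : N x -> exists y : sub_ltmod, sub_val y = x.
Proof. by move=> /asboolP Nx; exists (SubCar (Nx : x \in sub_pred sN)). Qed.

Lemma sub_val_hom : ltmod_hom (sub_val : sub_ltmod -> M).
Proof.
split=> [|V oV]; first exact: sub_val_linear.
by split; [apply: submodule_preimage => //; exact: lopen_submodule oV|exists V].
Qed.

Lemma sub_val_emb W : lopen sub_ltmod W -> exists2 U, lopen M U & sub_val @^-1` U `<=` W.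
Proof. by case. Qed.
End Sub.
Arguments sub_val {M N sN} _.

Definition embedding M N (f : M -> N) : Prop :=
  injective f /\ forall W, lopen M W -> exists2 U, lopen N U & f @^-1` U `<=` W.

(** A compatible family on [M] gives one on [N], whose limit lies in the closure of the
    image of [f]. *)
Lemma complete_separated_embedding M N (f : M -> N) :
  ltmod_hom f -> embedding f -> lclosed (range f) ->
  complete_separated N -> complete_separated M.
Proof.
move=> [fl fc] [finj femb] fcl [sN cN]; split.
  move=> x hx; apply: finj; rewrite (linear_map0 fl).
  apply: sN => V oV; have := hx _ (fc _ oV); rewrite !addset0; exact.
move=> c coh.
have [U V oU oV UV|y yP] := cN (fun V => f (c (f @^-1` V))).
  have := coh _ _ (fc _ oU) (fc _ oV) (preimage_subset UV).
  by rewrite !addset0 /= linear_mapB.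
have [a _ ay] : range f y.
  apply: fcl => U oU; exists (f (c (f @^-1` U))); first by exists (c (f @^-1` U)).
  by have := yP U oU; rewrite addset0.
exists a => W oW; have [U oU UW] := femb W oW.
rewrite addset0; apply: (@subgroup_trans _ _ _ (c (f @^-1` U))).
- exact: lopen_subgroup oW.
- by apply: UW; have := yP U oU; rewrite addset0 -ay -linear_mapB.
- by have := coh _ _ (fc _ oU) oW UW; rewrite addset0.
Qed.

Lemma complete_separated_sub M (N : set M) (sN : submodule N) :
  lclosed N -> complete_separated M -> complete_separated (sub_ltmod sN).
Proof.
move=> cN gM; apply: (complete_separated_embedding (@sub_val_hom M N sN)) => //.
  by split; [exact: sub_val_inj|exact: sub_val_emb].
suff -> : range (sub_val : sub_ltmod sN -> M) = N by [].
apply/seteqP; split=> [_ [x _ <-]|x Nx]; first exact: sub_valK.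
by have [y yx] := sub_val_onto sN Nx; exists y.
Qed.

(** ** Products *)
Section Prod.
Variables M N : ltmod R.

Definition prod_open : set (set (M * N)) :=
  [set W | submodule W /\ exists U V, [/\ lopen M U, lopen N V & U `*` V `<=` W]].

Lemma submoduleX (U : set M) (V : set N) :
  submodule U -> submodule V -> submodule (U `*` V).
Proof.
move=> [U0 UD] [V0 VD]; split=> // a x y [Ux Vx] [Uy Vy].
by split; [exact: UD|exact: VD].
Qed.

Definition prod_ltmod : ltmod R.
Proof.
apply: (@LtMod R (M * N)%type prod_open).
- by move=> U [].
- by split=> //; exists setT, setT; split; [exact: lopenT|exact: lopenT|exact: subsetT].
- move=> U V [sU [U1 [U2 [oU1 oU2 UU]]]] [sV [V1 [V2 [oV1 oV2 VV]]]].
  split; first exact: submoduleI.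
  exists (U1 `&` V1), (U2 `&` V2); split; [exact: lopenI|exact: lopenI|].
  by move=> x [[U1x V1x] [U2x V2x]]; split; [exact: UU|exact: VV].
- move=> U V [sU [U1 [U2 [oU1 oU2 UU]]]] sV UV; split=> //.
  by exists U1, U2; split=> //; exact: subset_trans UV.
Defined.

Lemma lopenX U V : lopen M U -> lopen N V -> lopen prod_ltmod (U `*` V).
Proof.
move=> oU oV; split; last by exists U, V; split=> // x.
by apply: submoduleX; [exact: lopen_submodule oU|exact: lopen_submodule oV].
Qed.

Lemma lopen_prod W : lopen prod_ltmod W ->
  exists U V, [/\ lopen M U, lopen N V & U `*` V `<=` W].
Proof. by case. Qed.

Lemma fst_hom : ltmod_hom (fst : prod_ltmod -> M).
Proof.
split=> // V oV; have := lopenX oV (lopenT N); congr (lopen _ _).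
by apply/seteqP; split=> [x []|x Vx].
Qed.

Lemma snd_hom : ltmod_hom (snd : prod_ltmod -> N).
Proof.
split=> // V oV; have := lopenX (lopenT M) oV; congr (lopen _ _).
by apply/seteqP; split=> [x []|x Vx].
Qed.

Lemma pair_hom P (f : P -> M) (g : P -> N) : ltmod_hom f -> ltmod_hom g ->
  ltmod_hom (fun x => (f x, g x) : prod_ltmod).
Proof.
move=> [fl fc] [gl gc].
have l : linear_map (fun x => (f x, g x) : prod_ltmod) by move=> a x y; rewrite fl gl.
split=> // W oW; have [U [V [oU oV UVW]]] := lopen_prod oW.
apply: (lopenS (lopenI (fc _ oU) (gc _ oV))) => [|x UVx].
  by apply: submodule_preimage => //; exact: lopen_submodule oW.
exact: UVW.
Qed.

Lemma complete_separated_prod :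
  complete_separated M -> complete_separated N -> complete_separated prod_ltmod.
Proof.
move=> [sM cM] [sN cN]; split.
  move=> [x y] h; congr pair; [apply: sM => U oU|apply: sN => U oU].
    by have := h _ (lopenX oU (lopenT N)); rewrite !addset0 => -[].
  by have := h _ (lopenX (lopenT M) oU); rewrite !addset0 => -[].
move=> c coh.
have [U V oU oV UV|a aP] := cM (fun U => (c (U `*` setT)).1).
  have := coh _ _ (lopenX oU (lopenT N)) (lopenX oV (lopenT N)) (setSX (@subset_refl _ _) UV).
  by rewrite !addset0 => -[].
have [U V oU oV UV|b bP] := cN (fun V => (c (setT `*` V)).2).
  have := coh _ _ (lopenX (lopenT M) oU) (lopenX (lopenT M) oV) (setSX UV (@subset_refl _ _)).
  by rewrite !addset0 => -[].
exists (a, b) => W oW; rewrite addset0.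
have [U [V [oU oV UVW]]] := lopen_prod oW; have oUV := lopenX oU oV.
apply: (@subgroup_trans _ _ _ (c (U `*` V))); first exact: lopen_subgroup oW.
  apply: UVW; split=> /=.
    apply: (@subgroup_trans _ _ _ (c (U `*` setT)).1); first exact: lopen_subgroup oU.
      by have := aP U oU; rewrite addset0.
    apply: subgroup_sym; first exact: lopen_subgroup oU.
    have := coh _ _ oUV (lopenX oU (lopenT N)) (setSX (@subsetT _ V) (@subset_refl _ _)).
    by rewrite addset0 => -[].
  apply: (@subgroup_trans _ _ _ (c (setT `*` V)).2); first exact: lopen_subgroup oV.
    by have := bP V oV; rewrite addset0.
  apply: subgroup_sym; first exact: lopen_subgroup oV.
  have := coh _ _ oUV (lopenX (lopenT M) oV) (setSX (@subset_refl _ _) (@subsetT _ U)).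
  by rewrite addset0 => -[].
by have := coh _ _ oUV oW UVW; rewrite addset0.
Qed.
End Prod.

(** ** Discrete modules *)
Section Discrete.
Variable M : lmodType R.

Definition discr_ltmod : ltmod R.
Proof.
apply: (@LtMod R M (@submodule R M)) => //; exact: submoduleI.
Defined.

Lemma complete_separated_discr : complete_separated discr_ltmod.
Proof.
have o0 : lopen discr_ltmod [set 0] by exact: submodule_zero.
by split; [exact: lclosed_lopen|exact: lcomplete_mod_lopen].
Qed.

End Discrete.

(** ** Quotients *)
Section Quot.
Variables (M : ltmod R) (N : set M) (sN : submodule N).

Definition quot_zmod : zmodClosed M := GRing.ZmodClosed.clone _ (sub_pred sN) _.

Definition quot_car : Type := Quotient.quot quot_zmod.
HB.instance Definition _ := GRing.Zmodule.copy quot_car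
  (Quotient.quot quot_zmod).

Definition quot_pi (x : M) : quot_car := \pi_(Quotient.quot quot_zmod) x.

Lemma quot_pi_onto (y : quot_car) : exists x, quot_pi x = y.
Proof. by exists (repr (y : Quotient.quot quot_zmod)); exact: reprK. Qed.

Lemma quot_piD x y : quot_pi (x + y) = quot_pi x + quot_pi y.
Proof. exact: (raddfD (\pi_(Quotient.quot quot_zmod))). Qed.

Lemma quot_pi_eq x y : quot_pi x = quot_pi y <-> N (x - y).
Proof.
split=> [/eqP|Nxy]; last apply/eqP.
  by rewrite /quot_pi -Quotient.idealrBE => /asboolP.
by rewrite /quot_pi -Quotient.idealrBE; exact/asboolP.
Qed.

Definition quot_scale (a : R) (y : quot_car) : quot_car :=
  quot_pi (a *: repr (y : Quotient.quot quot_zmod)).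

Lemma quot_scale_pi a x : quot_scale a (quot_pi x) = quot_pi (a *: x).
Proof.
apply/quot_pi_eq; rewrite -scalerBr; apply: submoduleZ => //.
by apply/quot_pi_eq; exact: reprK.
Qed.

Lemma quot_scaleA a b y : quot_scale a (quot_scale b y) = quot_scale (a * b) y.
Proof. by have [x <-] := quot_pi_onto y; rewrite !quot_scale_pi scalerA. Qed.

Lemma quot_scale1 : left_id 1 quot_scale.
Proof. by move=> y; have [x <-] := quot_pi_onto y; rewrite quot_scale_pi scale1r. Qed.

Lemma quot_scaleDr : right_distributive quot_scale +%R.
Proof.
move=> a y z; have [x <-] := quot_pi_onto y; have [t <-] := quot_pi_onto z.
by rewrite -quot_piD !quot_scale_pi scalerDr quot_piD.
Qed.

Lemma quot_scaleDl y : {morph quot_scale^~ y : a b / a + b}.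
Proof.
by move=> a b; have [x <-] := quot_pi_onto y; rewrite !quot_scale_pi scalerDl quot_piD.
Qed.

HB.instance Definition _ := GRing.Zmodule_isLmodule.Build R quot_car
  quot_scaleA quot_scale1 quot_scaleDr quot_scaleDl.

Lemma quot_pi_linear : linear_map quot_pi.
Proof. by move=> a x y; rewrite quot_piD -quot_scale_pi. Qed.

Lemma quot_pi_ker x : quot_pi x = 0 <-> N x.
Proof.
have {2}-> : x = x - 0 by rewrite subr0.
by rewrite -quot_pi_eq (linear_map0 quot_pi_linear).
Qed.

Definition quot_ltmod : ltmod R.
Proof.
apply: (@LtMod R quot_car [set V | submodule V /\ lopen M (quot_pi @^-1` V)]).
- by move=> U [].
- by split=> //; exact: lopenT.
- by move=> U V [sU oU] [sV oV]; split; [exact: submoduleI|exact: lopenI].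
- move=> U V [sU oU] sV UV; split=> //.
  apply: (lopenS oU) => [|x /UV //].
  by apply: submodule_preimage => //; exact: quot_pi_linear.
Defined.

Lemma quot_pi_hom : ltmod_hom (quot_pi : M -> quot_ltmod).
Proof. by split=> [|V []//]; exact: quot_pi_linear. Qed.

Lemma quot_pi_lopen U : lopen M U -> lopen quot_ltmod (quot_pi @` U).
Proof.
move=> oU; have sU := lopen_submodule oU.
split; first by apply: submodule_image => //; exact: quot_pi_linear.
apply: (lopenS oU) => [|x Ux]; last by exists x.
apply: submodule_preimage; first exact: quot_pi_linear.
by apply: submodule_image => //; exact: quot_pi_linear.
Qed.
End Quot.
End LtModTheory.
Arguments sub_val {R M N sN} _.

Lemma lcomplete_quotient (R : nzRingType) (M Q : ltmod R) (p : M -> Q) : ltmod_hom p ->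
  (forall y, exists x, p x = y) ->
  (forall U, lopen M U -> lopen Q (p @` U)) ->
  lcomplete_mod [set 0 : Q] <-> lcomplete_mod [set x | p x = 0].
Proof.
move=> [pl pc] psurj pim.
pose pA := GRing.isZmodMorphism.Build _ _ p (linear_mapB pl).
pose pa : {additive M -> Q} := HB.pack p pA.
exact: (@complete_quotient _ _ _ _ pa (lopen_filter M) (lopen_filter Q)).
Qed.

Lemma complete_separated_quot (R : nzRingType) (M : ltmod R) (N : set M) (sN : submodule N) :
  lclosed N -> lcomplete_mod N -> complete_separated (quot_ltmod sN).
Proof.
have kerE : [set x | (quot_pi sN : M -> quot_ltmod sN) x = 0] = N.
  by apply/seteqP; split=> x /= /quot_pi_ker.
move=> cN coN; split.
  move=> y; have [x <-] := quot_pi_onto y => h.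
  apply/(quot_pi_ker sN)/cN => U oU.
  have := h _ (quot_pi_lopen sN oU); rewrite addset0 => -[u Uu].
  move=> /esym/quot_pi_eq Nxu; exists (x - u) => //.
  by rewrite subKr.
apply/(lcomplete_quotient (quot_pi_hom sN)) => [y||].
- exact: quot_pi_onto.
- exact: quot_pi_lopen.
- by rewrite kerE.
Qed.

(** * Strict monomorphisms and epimorphisms *)

Definition open_surjection (R : nzRingType) (M N : ltmod R) (f : M -> N) : Prop :=
  (forall y, exists x, f x = y) /\ forall U, lopen M U -> lopen N (f @` U).

Section Factorization.
Variable R : nzRingType.
Implicit Types M N T : ltmod R.

Lemma lift_embedding M N T (i : M -> N) (t : T -> N) :
  ltmod_hom i -> embedding i -> ltmod_hom t -> (forall x, range i (t x)) ->
  exists2 u : T -> M, ltmod_hom u & forall x, i (u x) = t x.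
Proof.
move=> [il ic] [iinj iemb] [tl tc] tr.
have /choice[u uP] x : exists y, i y = t x by have [y _] := tr x; exists y.
have ul : linear_map u by move=> a x y; apply: iinj; rewrite il !uP tl.
exists u => //; split=> // W oW; have [U oU UW] := iemb W oW.
apply: (lopenS (tc _ oU)) => [|x Ux]; last by apply: UW; rewrite /= uP.
by apply: submodule_preimage => //; exact: lopen_submodule oW.
Qed.

Lemma descend_open_surjection M N T (p : M -> N) (t : M -> T) :
  ltmod_hom p -> open_surjection p -> ltmod_hom t -> (forall x, p x = 0 -> t x = 0) ->
  exists2 u : N -> T, ltmod_hom u & forall x, u (p x) = t x.
Proof.
move=> [pl pc] [psurj popen] [tl tc] pt.
have /choice[s sP] := psurj.
have up x : t (s (p x)) = t x.
  apply/eqP; rewrite -subr_eq0 -linear_mapB //; apply/eqP/pt.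
  by rewrite linear_mapB // sP subrr.
have ul : linear_map (t \o s).
  move=> a x y /=; rewrite -tl -[RHS]up pl !sP //.
exists (t \o s) => //; split=> // V oV.
apply: (lopenS (popen _ (tc _ oV))) => [|_ [x Vtx <-]]; last by rewrite /= up.
by apply: submodule_preimage => //; exact: lopen_submodule oV.
Qed.
End Factorization.

(** * Categories of complete separated linearly topologized modules *)

(** An equivalence of [C] with the category of complete separated linearly topologized
    modules: [fn] is full and faithful, and [und_onto] is essential surjectivity. *)
Record realization (R : nzRingType) (C : preadditive) := Realization {
  und : C -> ltmod R;
  fn : forall X Y : C, mor X Y -> und X -> und Y;
  und_complete_separated : forall X, complete_separated (und X);
  fn_hom : forall X Y (f : mor X Y), ltmod_hom (fn f);
  fn_ext : forall X Y (f g : mor X Y), (forall x, fn f x = fn g x) -> f = g;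
  fn_full : forall X Y (h : und X -> und Y), ltmod_hom h ->
    exists f : mor X Y, forall x, fn f x = h x;
  fn_cmp : forall X Y Z (g : mor Y Z) (f : mor X Y) x, fn (cmp g f) x = fn g (fn f x);
  fn_zero : forall X Y x, fn (0 : mor X Y) x = 0;
  und_onto : forall M, complete_separated M -> exists (X : C) (e : und X -> M) (e' : M -> und X),
    [/\ ltmod_hom e, ltmod_hom e', cancel e e' & cancel e' e]
}.
Arguments und {R C} r X.
Arguments fn {R C} r {X Y} f x.
Arguments und_complete_separated {R C} r X.
Arguments fn_hom {R C} r {X Y} f.
Arguments fn_ext {R C} r {X Y f g} _.
Arguments fn_full {R C r X Y h} _.
Arguments und_onto {R C} r {M} _.

Section StableKernels.
Variables (R : nzRingType) (C : preadditive) (r : realization R C).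
Local Notation "g \c f" := (@cmp C _ _ _ g f) (at level 40).
Local Notation und := (und r).
Local Notation fn := (fn r).

Lemma sub_object (M : ltmod R) (N : set M) :
  complete_separated M -> submodule N -> lclosed N ->
  exists (K : C) (k : und K -> M), [/\ ltmod_hom k, embedding k & range k = N].
Proof.
move=> gM sN cN; have [K [e [e' [he he' ee' e'e]]]] := und_onto r (complete_separated_sub sN cN gM).
exists K, (sub_val \o e); split.
- exact: ltmod_hom_comp (sub_val_hom sN) he.
- split=> [|W oW]; first exact: inj_comp (@sub_val_inj _ _ _ _) (can_inj ee').
  have [U oU UW] := sub_val_emb (proj2 he' _ oW).
  by exists U => // x /UW; rewrite /= ee'.
- apply/seteqP; split=> [_ [x _ <-]|x Nx]; first exact: sub_valK.
  by have [y <-] := sub_val_onto sN Nx; exists (e' y) => //=; rewrite e'e.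
Qed.

Lemma quot_object (M : ltmod R) (N : set M) :
  submodule N -> lclosed N -> lcomplete_mod N ->
  exists (Q : C) (p : M -> und Q),
    [/\ ltmod_hom p, open_surjection p & forall x, p x = 0 <-> N x].
Proof.
move=> sN cN coN.
have [Q [e [e' [he he' ee' e'e]]]] := und_onto r (complete_separated_quot sN cN coN).
exists Q, (e' \o quot_pi sN); split.
- exact: ltmod_hom_comp he' (quot_pi_hom sN).
- split=> [y|U oU].
    by have [x xy] := quot_pi_onto (e y); exists x; rewrite /= xy ee'.
  have := proj2 he _ (quot_pi_lopen sN oU); congr (lopen _ _).
  apply/seteqP; split=> [y [x Ux xy]|_ [x Ux <-]]; last by exists x; rewrite //= e'e.
  by exists x => //=; rewrite xy ee'.
- move=> x; rewrite -(quot_pi_ker sN) /=; split=> [|->]; last exact: linear_map0 he'.1.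
  by rewrite -{1}(linear_map0 he'.1) => /(can_inj e'e).
Qed.

Lemma discr_object (M : lmodType R) :
  exists (D : C) (e : und D -> M) (e' : M -> und D),
    [/\ linear_map e, cancel e e', cancel e' e & forall U, submodule U -> lopen (und D) U].
Proof.
have [D [e [e' [he he' ee' e'e]]]] := und_onto r (complete_separated_discr M).
exists D, e, e'; split=> // [|U sU]; first exact: he.1.
have o0 : lopen (discr_ltmod M) [set 0] by exact: submodule_zero.
apply: (lopenS (proj2 he _ o0)) => // x /= ex0.
by rewrite -(ee' x) ex0 (linear_map0 he'.1); exact: sU.1.
Qed.

Lemma embedding_kernel (X Y Z : C) (i : mor X Y) (f : mor Y Z) :
  embedding (fn i) -> (forall y, fn f y = 0 <-> range (fn i) y) -> is_kernel_of i f.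
Proof.
move=> emb rng; split.
  by apply: (fn_ext r) => x; rewrite fn_cmp fn_zero; apply/rng; exists x.
move=> T t ft0.
have [x|u hu uP] := lift_embedding (fn_hom r i) emb (fn_hom r t).
  by apply/rng; rewrite -fn_cmp ft0 fn_zero.
have [v vP] := fn_full hu; exists v; split.
  by apply: (fn_ext r) => x; rewrite fn_cmp vP uP.
move=> v' iv'; apply: (fn_ext r) => x; apply: (proj1 emb).
by rewrite vP uP -iv' fn_cmp.
Qed.

Lemma open_surjection_cokernel (X Y Z : C) (i : mor X Y) (p : mor Y Z) :
  open_surjection (fn p) -> (forall y, fn p y = 0 <-> range (fn i) y) ->
  is_cokernel_of p i.
Proof.
move=> osp rng; split.
  by apply: (fn_ext r) => x; rewrite fn_cmp fn_zero; apply/rng; exists x.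
move=> T t ti0.
have [y /rng [x _ <-]|u hu uP] := descend_open_surjection (fn_hom r p) osp (fn_hom r t).
  by rewrite -fn_cmp ti0 fn_zero.
have [v vP] := fn_full hu; exists v; split.
  by apply: (fn_ext r) => x; rewrite fn_cmp vP uP.
move=> v' vp; apply: (fn_ext r) => z; have [y <-] := proj1 osp z.
by rewrite vP uP -vp fn_cmp.
Qed.

(** If [i] is a kernel of [f], compare it with the inclusion [k] of the closed submodule
    on which [f] vanishes: each of [i] and [k] factors through the other. *)
Lemma kernel_embedding (X Y : C) (i : mor X Y) :
  is_kernel i -> embedding (fn i) /\ lclosed (range (fn i)).
Proof.
move=> [Z [f [fi0 univ]]].
have gY := und_complete_separated r Y; have gZ := und_complete_separated r Z.
have hf := fn_hom r f; have hi := fn_hom r i.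
have cN := lclosed_ker gZ.1 hf.
have [|K [k [hk ek rk]]] := sub_object gY _ cN.
  by apply: (@submodule_preimage _ _ _ _ hf.1 [set 0]); exact: submodule_zero.
have [k' k'P] := fn_full hk.
have [|u [iu _]] := univ K k'.
  apply: (fn_ext r) => x; rewrite fn_cmp fn_zero k'P.
  have : range k (k x) by exists x.
  by rewrite rk.
have ri x : range k (fn i x) by rewrite rk /= -fn_cmp fi0 fn_zero.
have [v hv vP] := lift_embedding hk ek hi ri.
have [v' v'P] := fn_full hv.
have [id_ idP] := fn_full (ltmod_hom_id (und X)).
have uv x : fn u (v x) = x.
  have [w [_ wu]] := univ X i fi0.
  suff : u \c v' = id_ by move=> /(congr1 (fun h => fn h x)); rewrite fn_cmp v'P idP.
  transitivity w; [symmetry|]; apply: wu; apply: (fn_ext r) => y.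
    by rewrite cmpA iu fn_cmp k'P v'P vP.
  by rewrite fn_cmp idP.
have rng : range (fn i) = [set y | fn f y = 0].
  rewrite -rk; apply/seteqP; split=> [_ [x _ <-] //|_ [x _ <-]].
  by exists (fn u x) => //; rewrite -fn_cmp iu k'P.
split; last by rewrite rng.
split=> [x y xy|W oW].
  by rewrite -(uv x) -(uv y); congr (fn u _); apply: (proj1 ek); rewrite !vP.
have [U oU UW] := proj2 ek _ (proj2 (fn_hom r u) _ oW).
by exists U => // x /=; rewrite -vP => /UW /=; rewrite uv.
Qed.

(** ** Sufficiency *)
Section Sufficiency.
Variables (K A : C) (i : mor K A).
Hypotheses (emb : embedding (fn i)) (clo : lclosed (range (fn i))).
Hypothesis comp : lcomplete_mod (range (fn i)).
Let hi := fn_hom r i.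
Let sub_rng : submodule (range (fn i)).
Proof. by apply: (submodule_image hi.1); exact: submoduleT. Qed.

Section Pushout.
Variables (B : C) (f : mor K B).
Let hf := fn_hom r f.
Let P := prod_ltmod (und A) (und B).
(** The quotient of [A * B] by [graph] is the pushout, and [trace W] is the preimage in [B]
    of the image of [W] there. *)
Let graph : set P := [set z | exists k, z.1 = fn i k /\ z.2 = - fn f k].

Let sub_graph : submodule graph.
Proof.
split; first by exists 0; rewrite (linear_map0 hi.1) (linear_map0 hf.1) oppr0.
move=> a x y [k [xk xk']] [l [yl yl']]; exists (a *: k + l).
by rewrite hi.1 hf.1 /= xk xk' yl yl' opprD scalerN.
Qed.

Let trace (W : set P) : set (und B) := [set b | addset W graph (0, b)].

Let trace_lopen W : lopen P W -> lopen (und B) (trace W).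
Proof.
move=> oW; have sW := lopen_submodule oW.
have [U [V [oU oV UVW]]] := lopen_prod oW.
apply: (lopenS oV) => [|b Vb].
  apply: (@submodule_preimage _ _ _ (fun b => (0, b) : P)) => [a x y|].
    by congr pair; rewrite /= scaler0 addr0.
  exact: submodule_addset.
apply: addsetl; first exact: submodule_subgroup.
by apply: UVW; split=> //; exact: subgroup0 (lopen_subgroup oU).
Qed.

(** The topology of [B] is induced from the pushout: if [f] sends [i^-1 U] into [V],
    then the trace of [U * V] is contained in [V]. *)
Let trace_base V : lopen (und B) V -> exists2 W, lopen P W & trace W `<=` V.
Proof.
move=> oV; have [U oU UV] := proj2 emb _ (proj2 hf _ oV).
exists (U `*` V); first exact: lopenX.
move=> b [[n m] [k /= [-> ->]] [/= Uk Vk]].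
rewrite -(addrK (fn f k) b); apply: subgroupB; first exact: lopen_subgroup oV.
  by rewrite opprK in Vk.
apply: UV => /=; rewrite -[fn i k]opprK; apply: subgroupN; first exact: lopen_subgroup oU.
by rewrite -sub0r.
Qed.

Let graph_closed : lclosed graph.
Proof.
move=> [x y] h.
have /clo[k _ ik] : forall U, lopen (und A) U -> addset U (range (fn i)) x.
  move=> U oU; have [[n m] [k /= [nk _]] [/= Ux _]] := h _ (lopenX oU (lopenT (und B))).
  by exists n => //; rewrite nk; exists k.
exists k; split=> //=; apply/eqP; rewrite -subr_eq0 opprK; apply/eqP.
apply: (und_complete_separated r B).1 => V oV; rewrite addset0.
have [W oW WV] := trace_base oV; apply: WV; rewrite /trace /=.
have -> : (0, y + fn f k) = (x, y) - (fn i k, - fn f k) :> P.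
  by congr pair; rewrite /= ?opprK // ik subrr.
apply: subgroupB; [|exact: h|].
  by apply: addset_subgroup; [exact: lopen_subgroup oW|exact: submodule_subgroup].
by apply: addsetr; [exact: lopen_subgroup oW|exists k].
Qed.

(** Completeness of [A] modulo the image of [i] provides a first coordinate [a] of the
    limit. Every coset in the family then meets the fibre over [a] in points [b W], which
    form a compatible family in [B]. *)
Let graph_complete : lcomplete_mod graph.
Proof.
move=> c coh.
have [U V oU oV UV|a aP] := comp (c := fun U => (c (U `*` setT)).1).
  have [[n m] [k /= [nk _]] [/= Ux _]] := coh _ _ (lopenX oU (lopenT (und B)))
    (lopenX oV (lopenT (und B))) (setSX (@subset_refl _ _) UV).
  by exists n => //; rewrite nk; exists k.
have sWg W : lopen P W -> subgroup (addset W graph).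
  by move=> oW; apply: addset_subgroup; [exact: lopen_subgroup oW|exact: submodule_subgroup].
pose I := {W : set P | lopen P W}.
have /choice[b bP] (W : I) : exists b, addset (sval W) graph ((a, b) - c (sval W)).
  case: W => W oW /=; have [U [V [oU oV UVW]]] := lopen_prod oW.
  have oUV := lopenX oU oV.
  have [[n m] [k /= [-> _]] [/= Uk _]] := coh _ _ oUV (lopenX oU (lopenT (und B)))
    (setSX (@subsetT _ V) (@subset_refl _ _)).
  have [_ [l _ <-] Ul] := aP U oU.
  (* moving along [graph] by [l - k] brings the first coordinate within [U] of [a] *)
  exists ((c (U `*` V)).2 - fn f (l - k)).
  apply: (@subgroup_trans _ _ _ (c (U `*` V))); [exact: sWg| |exact: coh].
  exists (fn i (l - k), - fn f (l - k)); first by exists (l - k).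
  apply: UVW; split=> /=; last first.
    rewrite opprK addrAC subrK subrr; exact: subgroup0 (lopen_subgroup oV).
  rewrite (linear_mapB hi.1).
  have := subgroupB (lopen_subgroup oU) Ul Uk.
  by rewrite subrACA; congr (U (_ - _)); rewrite opprB addrA subrK.
have pairB y y' : (a, y) - (a, y') = (0, y - y') :> P by congr pair; rewrite /= subrr.
have [b' b'P] : exists b', forall W : I, trace (sval W) (b' - b W).
  apply: (@complete_along _ _ I (fun W W' => sval W `<=` sval W')
    (fun W => trace (sval W)) b (lopen_filter _) (und_complete_separated r B).2).
  - by case=> W oW; exact: trace_lopen.
  - by move=> V oV; have [W oW WV] := trace_base oV; exists (exist _ W oW).
  - by move=> W W' WW' x; exact: addsetS.
  - case=> [W oW] [W' oW']; exists (exist _ _ (lopenI oW oW')).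
    by split; [exact: subIsetl|exact: subIsetr].
  - move=> W W' WW'; rewrite /trace /= -pairB.
    have sG := sWg _ (svalP W').
    apply: (subgroup_trans sG); first exact: addsetS WW' _ (bP W).
    apply: (subgroup_trans sG); first exact: coh (svalP W) (svalP W') WW'.
    exact: subgroup_sym sG (bP W').
exists (a, b') => W oW; pose W' : I := exist _ W oW.
by apply: (subgroup_trans (sWg _ oW)) (bP W'); rewrite pairB; exact: (b'P W').
Qed.

Lemma pushout_kernel : exists (Q : C) (j : mor B Q) (g : mor A Q),
  is_pushout i f j g /\ is_kernel j.
Proof.
have [Q [p [hp [psurj popen] pker]]] := quot_object sub_graph graph_closed graph_complete.
have h1 : ltmod_hom (fun a : und A => (a, 0) : P).
  exact: pair_hom (ltmod_hom_id _) (ltmod_hom_zero _ _).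
have h2 : ltmod_hom (fun b : und B => (0, b) : P).
  exact: pair_hom (ltmod_hom_zero _ _) (ltmod_hom_id _).
have [g gP] := fn_full (ltmod_hom_comp hp h1).
have [j jP] := fn_full (ltmod_hom_comp hp h2).
have pE a b : p (a, b) = fn g a + fn j b.
  by rewrite gP jP /= -(linear_mapD hp.1); congr (p (_, _)); rewrite /= ?addr0 ?add0r.
have pushout : is_pushout i f j g.
  split.
    apply: (fn_ext r) => k; rewrite !fn_cmp; apply/eqP.
    rewrite -subr_eq0 -(linear_mapN (fn_hom r j).1) -pE; apply/eqP/pker.
    by exists k.
  move=> T u v uivf.
  have hw : ltmod_hom (fun z : P => fn u z.1 + fn v z.2 : und T).
    apply: ltmod_homD; first exact: ltmod_hom_comp (fn_hom r u) (fst_hom _ _).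
    exact: ltmod_hom_comp (fn_hom r v) (snd_hom _ _).
  have [z /pker[k [zk zk']]|w hw' wP] := descend_open_surjection hp (conj psurj popen) hw.
    rewrite zk zk' (linear_mapN (fn_hom r v).1) -!fn_cmp uivf fn_cmp.
    by rewrite subrr.
  have [w' w'P] := fn_full hw'; exists w'; split.
    split; apply: (fn_ext r) => x; rewrite fn_cmp w'P.
      by rewrite gP /= wP /= (linear_map0 (fn_hom r v).1) addr0.
    by rewrite jP /= wP /= (linear_map0 (fn_hom r u).1) add0r.
  move=> w2 [w2g w2j]; apply: (fn_ext r) => x; rewrite w'P.
  have [[a b] <-] := psurj x; rewrite wP pE (linear_mapD (fn_hom r w2).1) -!fn_cmp.
  by rewrite w2g w2j.
exists Q, j, g; split=> //.
(* [j] is the kernel of the map to [A / iK] induced by the projection and zero *)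
have [Z [q [hq _ qker]]] := quot_object sub_rng clo comp.
have [q' q'P] := fn_full hq.
have [|w [[wg wj] _]] := proj2 pushout Z q' 0.
  apply: (fn_ext r) => k; rewrite !fn_cmp fn_zero q'P; apply/qker.
  by exists k.
exists Z, w; apply: embedding_kernel.
  split.
    apply: linear_map_inj (fn_hom r j).1 _ => b.
    rewrite jP => /pker[k [/= ik ->]].
    suff -> : k = 0 by rewrite (linear_map0 hf.1) oppr0.
    by apply: (proj1 emb); rewrite -ik (linear_map0 hi.1).
  move=> V oV; have [W oW WV] := trace_base oV.
  exists (p @` W); first exact: popen.
  move=> b [z Wz]; rewrite jP /= => zb; apply: WV.
  exists ((0, b) - z); last by rewrite subKr.
  by apply/pker; rewrite (linear_mapB hp.1) zb subrr.
move=> y; have [[a b] <-] := psurj y; rewrite pE; split.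
  rewrite (linear_mapD (fn_hom r w).1) -!fn_cmp wg wj fn_zero addr0 q'P.
  move=> /qker[k _ <-].
  exists (b + fn f k) => //.
  have : fn g (fn i k) = fn j (fn f k) by rewrite -!fn_cmp (proj1 pushout).
  by move=> ->; rewrite (linear_mapD (fn_hom r j).1) addrC.
by case=> b' _ <-; rewrite -fn_cmp wj fn_zero.
Qed.
End Pushout.

Let gA := und_complete_separated r A.

(** The pullback along [f : D -> A / iK] is the fibre product with the topology induced
    from [A * D]. Its projection [q] to [D] is again an open surjection, and the kernel of [q]
    is the copy of [K] in the first factor, so [q] is the cokernel of [K]. *)
Lemma quotient_cokernel : exists (Q : C) (p : mor A Q),
  is_cokernel_of p i /\ semi_stable_cokernel p.
Proof.
have [Q [p [hp osp pker]]] := quot_object sub_rng clo comp.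
have [p' p'P] := fn_full hp.
have p'E : fn p' = p by apply/funext.
exists Q, p'; split.
  by apply: open_surjection_cokernel; rewrite p'E.
move=> D f; have hf := fn_hom r f.
pose P := prod_ltmod (und A) (und D).
pose d (z : P) : und Q := p z.1 - fn f z.2.
have hd : ltmod_hom d.
  exact: ltmod_homB (ltmod_hom_comp hp (fst_hom _ _)) (ltmod_hom_comp hf (snd_hom _ _)).
have sN : submodule [set z | d z = 0].
  by apply: (@submodule_preimage _ _ _ d hd.1 [set 0]); exact: submodule_zero.
have [X [k [hk ek rk]]] := sub_object (complete_separated_prod gA (und_complete_separated r D)) sN
  (lclosed_ker (und_complete_separated r Q).1 hd).
have [g gP] := fn_full (ltmod_hom_comp (fst_hom _ _) hk).
have [q qP] := fn_full (ltmod_hom_comp (snd_hom _ _) hk).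
have kE x : k x = (fn g x, fn q x) by rewrite gP qP /=; case: (k x).
have kP a b : p a = fn f b -> exists x, fn g x = a /\ fn q x = b.
  move=> ab; have : range k (a, b) by rewrite rk /= /d /= ab subrr.
  by case=> x _; rewrite kE => -[]; exists x.
have pg x : p (fn g x) = fn f (fn q x).
  have : range k (k x) by exists x.
  by rewrite rk kE /= /d /= => /eqP; rewrite subr_eq0 => /eqP.
exists X, q, g; split.
  split; first by apply: (fn_ext r) => x; rewrite !fn_cmp p'E pg.
  move=> T u v puv.
  have [x|w hw wP] := lift_embedding hk ek (pair_hom (fn_hom r u) (fn_hom r v)).
    by rewrite rk /= /d /= -p'E -!fn_cmp puv subrr.
  have [w' w'P] := fn_full hw; exists w'; split.
    by split; apply: (fn_ext r) => x; have := wP x; rewrite fn_cmp w'P kE => -[].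
  move=> w2 [gw qw]; apply: (fn_ext r) => x; apply: (proj1 ek).
  by rewrite w'P wP kE -!fn_cmp gw qw.
have hm : ltmod_hom (fun x : und K => (fn i x, 0) : P).
  exact: pair_hom hi (ltmod_hom_zero _ _).
have [x|m hm' mP] := lift_embedding hk ek hm.
  rewrite rk /= /d /= (linear_map0 hf.1) subr0; apply/pker.
  by exists x.
have [m' m'P] := fn_full hm'.
exists K, m'; apply: open_surjection_cokernel.
  split=> [y|W oW].
    have [a ay] := proj1 osp (fn f y).
    by have [x [_ xy]] := kP a y ay; exists x.
  have [U oU UW] := proj2 ek _ oW; have [U1 [U2 [oU1 oU2 U12]]] := lopen_prod oU.
  apply: (lopenS (lopenI oU2 (proj2 hf _ (proj2 osp _ oU1)))).
    by apply: (submodule_image (fn_hom r q).1); exact: lopen_submodule oW.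
  move=> y [U2y [a U1a ay]]; have [x [xa xy]] := kP a y ay.
  by exists x => //; apply/UW/U12; rewrite /= kE xa xy.
move=> x; split=> [qx0|[y _ <-]]; last first.
  by rewrite m'P qP /= mP.
have /pker[y _ yx] : p (fn g x) = 0 by rewrite pg qx0 (linear_map0 hf.1).
exists y => //; apply: (proj1 ek); rewrite m'P mP kE yx qx0.
by [].
Qed.

Lemma stable_kernel_of_complete_quotient : stable_kernel i.
Proof. by split; [exact: pushout_kernel|exact: quotient_cokernel]. Qed.
End Sufficiency.

(** ** Necessity *)

(** In the pushout square along the identity of [K], the map [g] has a retraction [w] that
    carries [j] to [i]; hence [i] is a kernel of [h g] as soon as [j] is a kernel of [h]. *)
Lemma semi_stable_kernel_is_kernel (K A : C) (i : mor K A) :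
  semi_stable_kernel i -> is_kernel i.
Proof.
move=> /(_ K (idm K)) [B [j [g [[gi push] [Z [h [hj0 univ]]]]]]].
rewrite cmpm1 in gi.
have [|w [[wg wj] _]] := push A (idm A) i; first by rewrite cmp1m cmpm1.
exists Z, (h \c g); split; first by rewrite -cmpA gi.
move=> T t ht0; have [|u [ju uniq]] := univ T (g \c t); first by rewrite cmpA.
exists u; split; first by rewrite -wj -cmpA ju cmpA wg cmp1m.
by move=> u' iu'; apply: uniq; rewrite -gi -cmpA iu'.
Qed.

Lemma cokernel_epi (X Y Z T : C) (p : mor Y Z) (f : mor X Y) (u v : mor Z T) :
  is_cokernel_of p f -> u \c p = v \c p -> u = v.
Proof.
move=> [pf univ] upvp.
have [|w [_ wu]] := univ T (u \c p).
  rewrite -cmpA pf; apply: (fn_ext r) => x.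
  by rewrite fn_cmp !fn_zero (linear_map0 (fn_hom r u).1).
by rewrite -(wu u) // -(wu v).
Qed.

(** Pulling back along the discretization [D -> Q] gives a cokernel whose image lies over
    [p(A)]. The quotient of [D] by [p(A)] is discrete, hence an object, and it receives
    two equal composites from that cokernel: the projection and zero. *)
Lemma semi_stable_cokernel_surj (A Q : C) (p : mor A Q) :
  semi_stable_cokernel p -> forall y, exists x, fn p x = y.
Proof.
move=> ss y; have [D [e [e' [le ee' e'e oD]]]] := discr_object (und Q).
have he : ltmod_hom e.
  split=> // V oV; apply: oD; apply: submodule_preimage => //.
  exact: lopen_submodule oV.
have [f fP] := fn_full he.
have [P [q [g [[pg _] [X [h qh]]]]]] := ss D f.
have sN : submodule (e @^-1` range (fn p)).
  apply: submodule_preimage => //; apply: (submodule_image (fn_hom r p).1).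
  exact: submoduleT.
have oN := oD _ sN.
have [T [t [ht _ tker]]] := quot_object sN (lclosed_lopen oN) (lcomplete_mod_lopen oN).
have [t' t'P] := fn_full ht.
have t0 : t' = 0.
  apply: (cokernel_epi qh); apply: (fn_ext r) => x.
  rewrite !fn_cmp fn_zero t'P; apply/tker.
  by exists (fn g x) => //; rewrite -fP -!fn_cmp pg.
have /tker [x _ xy] : t (e' y) = 0 by rewrite -t'P t0 fn_zero.
by exists x; rewrite xy e'e.
Qed.

(** For an open [U], the quotient of [A] by [i(K) + U] is discrete; the morphism from [A] to
    it factors through [p], which makes [p(U)] open and puts the kernel of [p] inside
    [i(K) + U]. *)
Lemma cokernel_open_quotient (K A Q : C) (i : mor K A) (p : mor A Q) U :
  is_cokernel_of p i -> lopen (und A) U ->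
  exists2 V, lopen (und Q) V & forall x, V (fn p x) -> addset U (range (fn i)) x.
Proof.
move=> [pi0 univ] oU.
have sR : submodule (range (fn i)).
  by apply: (submodule_image (fn_hom r i).1); exact: submoduleT.
have sN := submodule_addset (lopen_submodule oU) sR.
have oN : lopen (und A) (addset U (range (fn i))).
  by apply: (lopenS oU) => //; apply: addsetl; exact: submodule_subgroup.
have [T [t [ht [_ tU] tker]]] := quot_object sN (lclosed_lopen oN) (lcomplete_mod_lopen oN).
have [t' t'P] := fn_full ht.
have [|w [wt _]] := univ T t'.
  apply: (fn_ext r) => k; rewrite fn_cmp fn_zero t'P; apply/tker.
  by apply: addsetr; [exact: lopen_subgroup oU|exists k].
have o0 : lopen (und T) [set 0].
  apply: (lopenS (tU _ oN)) => [|_ [x /tker xN <-] //]; exact: submodule_zero.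
exists (fn w @^-1` [set 0]); first exact: (proj2 (fn_hom r w)).
by move=> x /=; rewrite -fn_cmp wt t'P => /tker.
Qed.

Lemma stable_kernel_complete_quotient (K A : C) (i : mor K A) :
  stable_kernel i -> [/\ embedding (fn i), lclosed (range (fn i)) &
    lcomplete_mod (range (fn i))].
Proof.
move=> [/semi_stable_kernel_is_kernel/kernel_embedding[emb clo] [Q [p [cok ss]]]].
split=> //; have psurj := semi_stable_cokernel_surj ss; have hp := fn_hom r p.
have pi x : fn p (fn i x) = 0 by rewrite -fn_cmp (proj1 cok) fn_zero.
have kerE : [set x | fn p x = 0] = range (fn i).
  apply/seteqP; split=> [x /= px0|_ [x _ <-]]; last exact: pi.
  apply: clo => U oU; have [V oV VU] := cokernel_open_quotient cok oU.
  by apply: VU; rewrite px0; exact: (lopen_submodule oV).1.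
rewrite -kerE; apply/(lcomplete_quotient hp psurj); last exact: (und_complete_separated r Q).2.
move=> U oU; have [V oV VU] := cokernel_open_quotient cok oU.
apply: (lopenS oV) => [|y]; first exact: (submodule_image hp.1 (lopen_submodule oU)).
have [x <-] := psurj y; move=> /VU [_ [k _ <-] Uxk]; exists (x - fn i k) => //.
by rewrite (linear_mapB hp.1) pi subr0.
Qed.

Theorem stable_kernelP (K A : C) (i : mor K A) :
  stable_kernel i <-> [/\ embedding (fn i), lclosed (range (fn i)) &
    lcomplete_mod (range (fn i))].
Proof.
split; first exact: stable_kernel_complete_quotient.
by case; exact: stable_kernel_of_complete_quotient.
Qed.
End StableKernels.

(** * Linear topologies on abelian groups *)

Section LinearTopology.
Variable A : topologicalZmodType.
Implicit Types (U W F : set A) (O : set (set A)).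

Lemma nbhs_translate (x y : A) W : nbhs (x + y) W -> nbhs y [set u | W (x + u)].
Proof.
apply: (@continuous_comp _ _ _ (fun u => (x, u)) (fun z : A * A => z.1 + z.2) y).
  by apply: cvg_pair; [exact: cvg_cst|exact: cvg_id].
exact: add_continuous.
Qed.

Lemma nbhs0_translate (x : A) W : nbhs x W <-> nbhs 0 [set u | W (x + u)].
Proof.
split=> [Wx|Wx]; first by apply: nbhs_translate; rewrite addr0.
rewrite -[0](addNr x) in Wx; have := nbhs_translate Wx.
by congr (nbhs _ _); apply/seteqP; split=> u /=; rewrite addNKr.
Qed.

Lemma open_subgroup_nbhs U : subgroup U -> nbhs 0 U -> open U.
Proof.
move=> sU U0; rewrite openE => x Ux; apply/nbhs0_translate.
by apply: (filterS _ U0) => u Uu; exact: subgroupD.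
Qed.

Definition linear_base O : Prop :=
  (forall U, O U -> open U /\ subgroup U) /\
  (forall W, nbhs 0 W -> exists2 U, O U & U `<=` W).

Lemma nbhs_linear_base O x W : linear_base O ->
  nbhs x W <-> exists2 U, O U & forall u, U u -> W (x + u).
Proof.
move=> [Oo base]; rewrite nbhs0_translate; split=> [/base //|[U OU UW]].
have [oU sU] := Oo U OU; apply: (filterS UW).
by apply: open_nbhs_nbhs; split=> //; exact: subgroup0.
Qed.

Lemma closed_linear_base O F : linear_base O -> closed F <-> closed_mod O F.
Proof.
move=> bO; split=> [cF x h|cF x clx].
  apply: cF => W /(nbhs_linear_base _ _ bO)[U OU UW].
  have [n Fn Uxn] := h U OU; exists n; split=> //.
  rewrite -[n](subKr x); apply: UW; apply: subgroupN => //.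
  by have [] := proj1 bO U OU.
apply: cF => U OU; have [oU sU] := proj1 bO U OU.
have [|n [Fn Un]] := clx [set y | U (y - x)].
  apply/(nbhs_linear_base _ _ bO); exists U => // u Uu.
  by rewrite /= addrAC subrr add0r.
by exists n => //; exact: subgroup_sym.
Qed.
End LinearTopology.

Section LinearTopologyMaps.
Variables (A B : topologicalZmodType) (OA : set (set A)) (OB : set (set B)).
Hypotheses (bA : linear_base OA) (bB : linear_base OB).
Variable f : A -> B.
Hypothesis fB : zmod_morphism f.

Let f0 : f 0 = 0. Proof. by rewrite -(subrr 0) fB subrr. Qed.

Lemma continuous_linear_base :
  (forall V, OB V -> open (f @^-1` V)) -> continuous f.
Proof.
move=> fc x W /(nbhs_linear_base _ _ bB)[V OV VW].
have [_ sV] := proj1 bB V OV; apply/nbhs0_translate.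
apply: (@filterS _ _ _ (f @^-1` V)) => [u Vu /=|]; last first.
  by apply: open_nbhs_nbhs; split; [exact: fc|rewrite /= f0; exact: subgroup0].
have -> : f (x + u) = f x + f u by rewrite -[u in LHS]opprK fB -[- u]sub0r fB f0 sub0r opprK.
exact: VW.
Qed.

(** Closedness of the image of the complement of an open subgroup [W] gives a
    neighbourhood of zero that meets the image of [f] only inside [f(W)]. *)
Lemma injective_closed_mapP : injective_closed_map f <->
  injective f /\
  (forall W, OA W -> exists2 U, OB U & f @^-1` U `<=` W) /\ closed_mod OB (range f).
Proof.
split=> [[finj fcl]|[finj [femb fcl]]]; split=> //; last first.
  move=> F cF; apply/(closed_linear_base _ bB) => y h.
  have [|x _ xy] := fcl y.
    by move=> U /h[_ [x _ <-] Uyx]; exists (f x) => //; exists x.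
  exists x => //; apply/(proj1 (closed_linear_base F bA)) => // W OW.
  have [U OU UW] := femb W OW; have [_ [z Fz <-] Uyz] := h U OU.
  by exists z => //; apply: UW; rewrite /= fB xy.
split=> [W OW|]; last by apply/(closed_linear_base _ bB)/fcl; exact: closedT.
have [oW sW] := proj1 bA W OW.
have /(closed_linear_base _ bB) cW := fcl _ (open_closedC oW).
apply: contrapT => nU.
have [|x nWx fx0] := cW 0; last first.
  by apply: nWx; rewrite (finj x 0) ?f0 //; exact: subgroup0.
move=> U OU; apply: contrapT => nUW; apply: nU; exists U => // x Ux.
apply: contrapT => nWx; apply: nUW; exists (f x); first by exists x.
by rewrite sub0r; apply: subgroupN => //; case: (proj1 bB U OU).
Qed.
End LinearTopologyMaps.

(** * Limits of quotients as compatible families *)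
Section Limits.
Variables (A : zmodType) (O : set (set A)) (I : Type) (S : I -> zmodClosed A).
Hypothesis fO : subgroup_filter O.
Hypothesis OS : forall i, O [set x | x \in S i].
Hypothesis baseS : forall U, O U -> exists i, [set x | x \in S i] `<=` U.

Lemma lim_quot_eq (c d : lim_quot S) : (forall i, lim_proj c i = lim_proj d i) -> c = d.
Proof.
case: c d => [c cP] [d dP] /= cd.
have ecd : c = d by apply: functional_extensionality_dep.
by subst d; congr LimQuot; exact: Prop_irrelevance.
Qed.

Lemma lim_proj_eq (c : lim_quot S) i a :
  lim_proj (to_lim S a) i = lim_proj c i <-> a - repr (lim_proj c i) \in S i.
Proof.
by rewrite Quotient.idealrBE reprK /=; split=> [/eqP|/eqP].
Qed.

Lemma separated_limP : injective (to_lim S) <-> closed_mod O [set 0].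
Proof.
split=> [inj x h|cl a b ab].
  apply: inj; apply: lim_quot_eq => i /=; apply/eqP.
  by rewrite -Quotient.idealrBE subr0; have := h _ (OS i); rewrite addset0.
apply/eqP; rewrite -subr_eq0; apply/eqP/cl => U OU; rewrite addset0.
have [i iU] := baseS OU; apply: iU => /=; rewrite Quotient.idealrBE; apply/eqP.
exact: (congr1 (fun c => lim_proj c i) ab).
Qed.

Lemma complete_limP :
  (forall c, exists a, to_lim S a = c) <-> complete_mod O [set 0].
Proof.
split=> [compS c coh|cO c]; last first.
  have [a aP] : exists a, forall i, a - repr (lim_proj c i) \in S i.
    apply: (@complete_along _ _ I (fun i j => {subset S i <= S j})
      (fun i => [set x | x \in S i]) (fun i => repr (lim_proj c i)) fO cO OS) => //.
      move=> i j; have [k kij] := baseS (subgroup_filterI fO (OS i) (OS j)).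
      by exists k; split=> x /kij[].
    move=> i j ij /=; rewrite Quotient.idealrBE reprK.
    by rewrite (lim_compat c ij).
  by exists a; apply: lim_quot_eq => i; apply/lim_proj_eq.
have sO U : O U -> subgroup U by exact: subgroup_filter_subgroup.
pose c_ i := \pi_(Quotient.quot (S i)) (c [set x | x \in S i]).
have cP i j : {subset S i <= S j} -> \pi_(Quotient.quot (S j)) (repr (c_ i)) = c_ j.
  move=> ij; rewrite to_lim_compat //; apply/eqP; rewrite -Quotient.idealrBE.
  by have := coh _ _ (OS i) (OS j) ij; rewrite addset0.
have [a aP] := compS (LimQuot cP); exists a => U OU; rewrite addset0.
have [i iU] := baseS OU; apply: (@subgroup_trans _ _ _ (c [set x | x \in S i])).
- exact: sO.
- apply: iU => /=; rewrite Quotient.idealrBE; apply/eqP.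
  exact: (congr1 (fun c => lim_proj c i) aP).
- by have := coh _ _ (OS i) OU iU; rewrite addset0.
Qed.
End Limits.

(** * The topology defined by a filter of open submodules *)
Section LinTop.
Variables (R : nzRingType) (M : ltmod R).

Definition lintop : Type := M.
HB.instance Definition _ := GRing.Zmodule.copy lintop M.

Definition lintop_nbhs (x : lintop) : set (set lintop) :=
  [set W | exists2 U, lopen M U & forall u, U u -> W (x + u)].

HB.instance Definition _ := hasNbhs.Build lintop lintop_nbhs.

Lemma lintop_nbhs_filter (x : lintop) : ProperFilter (nbhs x).
Proof.
split=> [[U oU]|]; first by move/(_ 0); apply; exact: subgroup0 (lopen_subgroup oU).
split; first by exists setT => //; exact: lopenT.
- move=> V W [U oU UV] [U' oU' UW]; exists (U `&` U'); first exact: lopenI.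
  by move=> u [Uu U'u]; split; [exact: UV|exact: UW].
- by move=> V W VW [U oU UV]; exists U => // u Uu; exact/VW/UV.
Qed.

Lemma lintop_nbhs_singleton (x : lintop) W : nbhs x W -> W x.
Proof.
move=> [U oU UW]; rewrite -[x]addr0; apply: UW; exact: subgroup0 (lopen_subgroup oU).
Qed.

Lemma lintop_nbhs_nbhs (x : lintop) W : nbhs x W -> nbhs x (nbhs^~ W).
Proof.
move=> [U oU UW]; exists U => // u Uu; exists U => // v Uv.
by rewrite -addrA; apply: UW; exact: subgroupD (lopen_subgroup oU) Uu Uv.
Qed.

HB.instance Definition _ := Nbhs_isNbhsTopological.Build lintop
  lintop_nbhs_filter lintop_nbhs_singleton lintop_nbhs_nbhs.

Lemma lintop_sub_continuous : continuous (fun z : lintop * lintop => z.1 - z.2).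
Proof.
move=> [x y] W [U oU UW]; have sU := lopen_subgroup oU.
exists ([set z | U (z - x)], [set z | U (z - y)]).
  by split; exists U => // u Uu; rewrite /= addrAC subrr add0r.
move=> [z t] [/= Uz Ut]; have := UW _ (subgroupB sU Uz Ut).
by congr W; rewrite subrACA addrC subrK.
Qed.

HB.instance Definition _ :=
  PreTopologicalNmodule_isTopologicalZmodule.Build lintop lintop_sub_continuous.

Lemma lopen_open U : lopen M U -> open (U : set lintop).
Proof.
move=> oU; rewrite openE => x Ux; exists U => // u Uu.
exact: subgroupD (lopen_subgroup oU) Ux Uu.
Qed.

Lemma open_lopen U : submodule U -> open (U : set lintop) -> lopen M U.
Proof.
move=> sU oU.
have [V oV VU] : nbhs (0 : lintop) U by apply: open_nbhs_nbhs; split=> //; case: sU.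
by apply: (lopenS oV) => // v /VU; rewrite add0r.
Qed.
End LinTop.

(** * Abelian groups as modules over the integers *)

Lemma subgroup_submodule_int (M : lmodType int) (U : set M) :
  subgroup U -> submodule U.
Proof.
move=> sU; split=> [|a x y Ux Uy]; first exact: subgroup0.
apply: subgroupD => //; rewrite -[a]intz scaler_int.
have Un n : U (x *+ n).
  by elim: n => [|n IH]; [exact: subgroup0|rewrite mulrS; exact: subgroupD].
by case: a => n; [exact: Un|rewrite NegzE mulrNz; apply: subgroupN => //; exact: Un].
Qed.

Lemma zmod_morphism_int (M N : lmodType int) (f : M -> N) :
  zmod_morphism f -> linear_map f.
Proof.
move=> fB; pose fA := GRing.isZmodMorphism.Build _ _ f fB.
pose fa : {additive M -> N} := HB.pack f fA.
have -> : f = fa by [].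
move=> a x y; rewrite raddfD; congr (_ + _).
by rewrite -[a in LHS]intz -[a in RHS]intz !scaler_int raddfMz.
Qed.

Section TopZmod.
Variable A : topologicalZmodType.

Definition zmod_ltmod : ltmod int.
Proof.
apply: (@LtMod int (zmodule A) [set U : set (zmodule A) | submodule U /\ open (U : set A)]).
- by move=> U [].
- by split=> //; exact: openT.
- by move=> U V [sU oU] [sV oV]; split; [exact: submoduleI|exact: openI].
- move=> U V [sU oU] sV UV; split=> //.
  apply: open_subgroup_nbhs; first exact: submodule_subgroup sV.
  by apply: (filterS UV); apply: open_nbhs_nbhs; split=> //; case: sU.
Defined.

Lemma lopen_open_subgroup (U : open_subgroup A) : lopen zmod_ltmod [set x | x \in U].
Proof.
split; last exact: open_subgroup_open.
apply: subgroup_submodule_int; split=> [|x y Ux Uy] /=; first exact: rpred0.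
exact: rpredB.
Qed.

Lemma open_subgroup_lopen U : lopen zmod_ltmod U ->
  exists V : open_subgroup A, [set x | x \in V] = U.
Proof.
move=> [sU oU]; pose V : zmodClosed A := quot_zmod (M := zmod_ltmod) sU.
have VU : [set x | x \in V] = U by apply/seteqP; split=> x /asboolP.
have oV : open [set x | x \in V] by rewrite VU.
by exists (OpenSubgroup oV).
Qed.

Lemma separatedP : separated A <-> lclosed [set 0 : zmod_ltmod].
Proof.
apply: separated_limP; first exact: lopen_open_subgroup.
by move=> U /open_subgroup_lopen[V <-]; exists V.
Qed.

Lemma completeP : complete A <-> lcomplete_mod [set 0 : zmod_ltmod].
Proof.
apply: (@complete_limP A _ _ _ (lopen_filter zmod_ltmod)).
  exact: lopen_open_subgroup.
by move=> U /open_subgroup_lopen[V <-]; exists V.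
Qed.

Lemma linear_topology_base : linear_topology A -> linear_base (lopen zmod_ltmod).
Proof.
move=> lin; split=> [U [sU oU]|W /lin[U UW]].
  by split=> //; exact: submodule_subgroup sU.
by exists [set x | x \in U] => //; exact: lopen_open_subgroup.
Qed.
End TopZmod.

Lemma cts_additive_ltmod_hom (A B : topologicalZmodType) (f : cts_additive A B) :
  ltmod_hom (f : zmod_ltmod A -> zmod_ltmod B).
Proof.
have /asboolP[fB /continuousP fc] := cts_additiveP f.
have fl : linear_map (f : zmod_ltmod A -> zmod_ltmod B) by exact: zmod_morphism_int.
split=> // V [sV oV]; split; last exact: fc.
exact: submodule_preimage.
Qed.

Lemma zmod_ltmod_full (A B : topZsc) (h : zmod_ltmod A -> zmod_ltmod B) :
  ltmod_hom h -> exists f : cts_additive A B, forall x, f x = h x.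
Proof.
move=> [hl hc]; suff hP : (h : A -> B) \in @cts_additive_pred A B.
  by exists (CtsAdditive hP).
have hB : @zmod_morphism A B h by move=> x y; exact: (linear_mapB hl).
apply/asboolP; split=> //.
have hco V : lopen (zmod_ltmod B) V -> open ((h : A -> B) @^-1` V).
  by move=> /hc[].
refine (@continuous_linear_base A B _ (linear_topology_base (@topZsc_linear B)) h hB hco).
Qed.

(** The integers act on [M] only through its addition, so [lintop M] has the same open
    submodules as [M]. *)
Lemma zmod_ltmod_onto (M : ltmod int) : complete_separated M ->
  exists (X : topZsc) (e : zmod_ltmod X -> M) (e' : M -> zmod_ltmod X),
    [/\ ltmod_hom e, ltmod_hom e', cancel e e' & cancel e' e].
Proof.
move=> [sM cM]; pose X : topologicalZmodType := lintop M.
have oE : lopen (zmod_ltmod X) = lopen M.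
  apply/seteqP; split=> U; last first.
    move=> oU; split; last exact: lopen_open.
    by apply: subgroup_submodule_int; exact: lopen_subgroup oU.
  move=> [/submodule_subgroup sU oU]; apply: open_lopen => //.
  exact: subgroup_submodule_int.
have linX : linear_topology X.
  move=> W [U oU UW]; rewrite -oE in oU.
  have [V VU] := open_subgroup_lopen oU; exists V; rewrite VU => u /UW.
  by rewrite add0r.
have sX : separated X by apply/separatedP; rewrite /lclosed oE.
have cX : complete X by apply/completeP; rewrite /lcomplete_mod oE.
exists (TopZsc linX sX cX), id, id; split=> //.
  by split; [apply: zmod_morphism_int => x y|move=> V oV; rewrite oE].
by split; [apply: zmod_morphism_int => x y|move=> V; rewrite oE].
Qed.

Definition TopScZ_realization : realization int TopScZ.
Proof.
apply: (@Realization int TopScZ (fun X : topZsc => zmod_ltmod X)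
  (fun (X Y : topZsc) (f : cts_additive X Y) => f)).
- by move=> X; split; [exact/separatedP/topZsc_separated|exact/completeP/topZsc_complete].
- by move=> X Y f; exact: cts_additive_ltmod_hom.
- by move=> X Y f g; exact: cts_additive_ext.
- exact: zmod_ltmod_full.
- by [].
- by [].
- exact: zmod_ltmod_onto.
Defined.

(** * Vector spaces *)

Section TopVect.
Variables (k : fieldType) (V : topVectType k).

Definition vect_ltmod : ltmod k.
Proof.
apply: (@LtMod k V [set U : set V | submodule U /\ open U]).
- by move=> U [].
- by split=> //; exact: openT.
- by move=> U W [sU oU] [sW oW]; split; [exact: submoduleI|exact: openI].
- move=> U W [sU oU] sW UW; split=> //.
  apply: open_subgroup_nbhs; first exact: submodule_subgroup sW.
  by apply: (filterS UW); apply: open_nbhs_nbhs; split=> //; case: sU.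
Defined.

Lemma lopen_open_subspace (U : open_subspace V) : lopen vect_ltmod [set x | x \in U].
Proof.
split; last exact: open_subspace_open.
split=> [|a x y Ux Uy] /=; first exact: rpred0.
by apply: rpredD => //; exact: rpredZ.
Qed.

Lemma open_subspace_lopen U : lopen vect_ltmod U ->
  exists W : open_subspace V, [set x | x \in W] = U.
Proof.
move=> [sU oU].
pose W : submodClosed V := GRing.SubmodClosed.clone _ _ (sub_pred (M := vect_ltmod) sU) _.
have WU : [set x | x \in W] = U by apply/seteqP; split=> x /asboolP.
have oW : open [set x | x \in W] by rewrite WU.
by exists (OpenSubspace oW).
Qed.

Lemma vseparatedP : vseparated V <-> lclosed [set 0 : vect_ltmod].
Proof.
apply: separated_limP; first exact: lopen_open_subspace.
by move=> U /open_subspace_lopen[W <-]; exists W.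
Qed.

Lemma vcompleteP : vcomplete V <-> lcomplete_mod [set 0 : vect_ltmod].
Proof.
apply: (@complete_limP V _ _ _ (lopen_filter vect_ltmod)).
  exact: lopen_open_subspace.
by move=> U /open_subspace_lopen[W <-]; exists W.
Qed.

Lemma vlinear_topology_base : vlinear_topology V -> linear_base (lopen vect_ltmod).
Proof.
move=> lin; split=> [U [sU oU]|W /lin[U UW]].
  by split=> //; exact: submodule_subgroup sU.
by exists [set x | x \in U] => //; exact: lopen_open_subspace.
Qed.
End TopVect.

Lemma cts_linear_ltmod_hom (k : fieldType) (V W : topVectType k) (f : cts_linear V W) :
  ltmod_hom (f : vect_ltmod V -> vect_ltmod W).
Proof.
have /asboolP[fl /continuousP fc] := cts_linearP f.
split=> // U [sU oU]; split; last exact: fc.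
exact: (@submodule_preimage _ (vect_ltmod V) (vect_ltmod W)).
Qed.

Lemma vect_ltmod_full (k : fieldType) (V W : topVsc k) (h : vect_ltmod V -> vect_ltmod W) :
  ltmod_hom h -> exists f : cts_linear V W, forall x, f x = h x.
Proof.
move=> [hl hc]; suff hP : (h : V -> W) \in @cts_linear_pred k V W.
  by exists (CtsLinear hP).
have hB : @zmod_morphism V W h by move=> x y; exact: (linear_mapB hl).
apply/asboolP; split=> //.
have hco U : lopen (vect_ltmod W) U -> open ((h : V -> W) @^-1` U).
  by move=> /hc[].
refine (@continuous_linear_base V W _ (vlinear_topology_base (@topVsc_linear k W)) h hB hco).
Qed.

Section VectLinTop.
Variables (k : fieldType) (M : ltmod k).

Definition vlintop : Type := lintop M.
HB.instance Definition _ := TopologicalZmodule.copy vlintop (lintop M).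

Definition vlintop_scale (a : k) (x : vlintop) : vlintop := a *: (x : M).

Lemma vlintop_scale_continuous :
  continuous (fun z : discrete_topology k * vlintop => vlintop_scale z.1 z.2).
Proof.
move=> [a x] W [U oU UW].
exists ([set a], [set z | U ((z : M) - x)]).
  split; first by move=> _ ->.
  by exists U => // u Uu; rewrite /= addrAC subrr add0r.
move=> [_ z] [/= -> Uz].
have := UW _ (submoduleZ a (lopen_submodule oU) Uz).
by congr W; rewrite /vlintop_scale /= scalerBr addrC subrK.
Qed.

HB.instance Definition _ := hasDiscreteScale.Build k vlintop
  (@scalerA k M) (@scale1r k M) (@scalerDr k M) (@scalerDl k M)
  vlintop_scale_continuous.
End VectLinTop.

Lemma vect_ltmod_onto (k : fieldType) (M : ltmod k) : complete_separated M ->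
  exists (X : topVsc k) (e : vect_ltmod X -> M) (e' : M -> vect_ltmod X),
    [/\ ltmod_hom e, ltmod_hom e', cancel e e' & cancel e' e].
Proof.
move=> [sM cM]; pose X : topVectType k := vlintop M.
have oE : lopen (vect_ltmod X) = lopen M.
  apply/seteqP; split=> U; last first.
    by move=> oU; split; [exact: lopen_submodule oU|exact: lopen_open].
  by move=> [sU oU]; exact: open_lopen.
have linX : vlinear_topology X.
  move=> W [U oU UW]; rewrite -oE in oU.
  have [V VU] := open_subspace_lopen oU; exists V; rewrite VU => u /UW.
  by rewrite add0r.
have sX : vseparated X by apply/vseparatedP; rewrite /lclosed oE.
have cX : vcomplete X by apply/vcompleteP; rewrite /lcomplete_mod oE.
exists (TopVsc linX sX cX), id, id; split=> //.
  by split=> // V oV; rewrite oE.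
by split=> // V; rewrite oE.
Qed.

Definition TopScVect_realization (k : fieldType) : realization k (TopScVect k).
Proof.
apply: (@Realization k (TopScVect k) (fun X : topVsc k => vect_ltmod X)
  (fun (X Y : topVsc k) (f : cts_linear X Y) => f)).
- by move=> X; split; [exact/vseparatedP/topVsc_separated|exact/vcompleteP/topVsc_complete].
- by move=> X Y f; exact: cts_linear_ltmod_hom.
- by move=> X Y f g; exact: cts_linear_ext.
- exact: vect_ltmod_full.
- by [].
- by [].
- exact: vect_ltmod_onto.
Defined.

(** * Completeness of topological quotients *)

(** The projection to the quotient is an open surjection with kernel [N]. *)
Lemma topquot_complete_mod (A : topologicalZmodType) (N : zmodClosed A) :
  complete (topquot N) <-> lcomplete_mod [set x : zmod_ltmod A | x \in N].
Proof.
rewrite completeP.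
pose p : zmod_ltmod A -> zmod_ltmod (topquot N) := @topquot_pi A N.
have pl : linear_map p by apply: zmod_morphism_int; exact: topquot_piB.
have hp : ltmod_hom p.
  split=> // V [sV oV]; split; first exact: submodule_preimage.
  by move/continuousP : (@topquot_pi_cts A N); apply.
have kerE : [set x | p x = 0] = [set x : zmod_ltmod A | x \in N].
  have p0 x : (x \in N) = (p x == 0).
    by rewrite -[x in LHS]subr0 Quotient.idealrBE -(linear_map0 pl).
  by apply/seteqP; split=> x /=; rewrite p0 => /eqP.
rewrite -kerE; apply: lcomplete_quotient => //; first exact: topquot_piP.
move=> U [sU oU]; split; first exact: submodule_image.
apply: open_subgroup_nbhs; first exact: (submodule_subgroup (submodule_image pl sU)).
rewrite -(linear_map0 pl); apply: topquot_pi_nbhs.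
by apply: open_nbhs_nbhs; split=> //; case: sU.
Qed.

Lemma topvquot_complete_mod (k : fieldType) (V : topVectType k) (N : submodClosed V) :
  vcomplete (topvquot N) <-> lcomplete_mod [set x : vect_ltmod V | x \in N].
Proof.
rewrite vcompleteP.
pose p : vect_ltmod V -> vect_ltmod (topvquot N) := @topvquot_pi k V N.
have pl : linear_map p.
  by move=> a x y; rewrite /p topvquot_piD -topvquot_scale_pi.
have hp : ltmod_hom p.
  split=> // U [sU oU]; split; first exact: submodule_preimage.
  by move/continuousP : (@topquot_pi_cts V (submod_zmod N)); apply.
have kerE : [set x | p x = 0] = [set x : vect_ltmod V | x \in N].
  have p0 x : (x \in submod_zmod N) = (p x == 0).
    by rewrite -[x in LHS]subr0 Quotient.idealrBE -(linear_map0 pl).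
  apply/seteqP; split=> x /= => [/eqP|Nx]; first by rewrite -p0.
  by apply/eqP; rewrite -p0.
rewrite -kerE; apply: lcomplete_quotient => //; first exact: topvquot_piP.
move=> U [sU oU]; split; first exact: submodule_image.
apply: open_subgroup_nbhs; first exact: (submodule_subgroup (submodule_image pl sU)).
rewrite -(linear_map0 pl); apply: (@topquot_pi_nbhs V (submod_zmod N)).
by apply: open_nbhs_nbhs; split=> //; case: sU.
Qed.

Theorem corollary8p5 (k : fieldType) :
  (forall (K A : topZsc) (i : cts_additive K A),
     @stable_kernel TopScZ K A i <->
     injective_closed_map i /\ complete (topquot (image_subgroup i)))
  /\
  (forall (K V : topVsc k) (i : cts_linear K V),
     @stable_kernel (TopScVect k) K V i <->
     injective_closed_map i /\ vcomplete (topvquot (image_subspace i))).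
Proof.
split=> K A i.
- have /asboolP[iB _] := cts_additiveP i.
  have rngE : [set x : zmod_ltmod A | x \in image_subgroup i] = range i.
    by apply/seteqP; split=> x /asboolP.
  rewrite (stable_kernelP TopScZ_realization i) topquot_complete_mod rngE.
  rewrite (injective_closed_mapP (linear_topology_base (@topZsc_linear K))
    (linear_topology_base (@topZsc_linear A)) iB).
  by split=> [[[inj emb] clo comp]|[[inj [emb clo]] comp]].
- have /asboolP[il _] := cts_linearP i.
  have rngE : [set x : vect_ltmod A | x \in image_subspace i] = range i.
    by apply/seteqP; split=> x /asboolP.
  rewrite (stable_kernelP (TopScVect_realization k) i) topvquot_complete_mod rngE.
  rewrite (injective_closed_mapP (vlinear_topology_base (@topVsc_linear k K))
    (vlinear_topology_base (@topVsc_linear k A)) (linear_mapB il)).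
  by split=> [[[inj emb] clo comp]|[[inj [emb clo]] comp]].
Qed.
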